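(* Let $G$ be a group acting freely, cellularly, and cocompactly on a CAT($0$) cube complex $X$, and let $V$ be the set of vertices of $X$. If $X/G$ is Eulerian of dimension $n$, then for any $x,y\in V/G$, the reciprocal $\overline{\lambda}_{x,y}$ of the characteristic series $\lambda_{x,y}$ exists and is given by $$\overline{\lambda}_{x,y}=(-1)^n\lambda_{x,y}^*.$$
   Context: A cube complex is a piecewise-Euclidean metric cell complex obtained by gluing Euclidean cubes via isometries along faces. It is CAT($0$) if it is simply connected (in particular connected) and the link $\mathrm{Lk}(v)$ of every vertex $v$ is a flag simplicial complex. Eulerian: a cell complex $K$ in which the link of every nonempty cell is a simplicial complex is Eulerian of dimension $n$ if every maximal cell is $n$-dimensional and $\chi(\mathrm{Lk}(\sigma))=1+(-1)^{\dim\mathrm{Lk}(\sigma)}$ for every nonempty cell $\sigma$ (the empty link has dimension $-1$ and Euler characteristic $0$). Diagonals: a (directed) diagonal $d$ of $X$ is a segment from a vertex $\alpha(d)$ of a cube $C(d)$ to the opposite vertex $\omega(d)$; a trivial diagonal is a vertex ($\alpha(d)=\omega(d)$, $C(d)$ a point). $d^*$ is the oppositely oriented diagonal, $|d|=\dim C(d)$, and $\sigma(d)$ is the simplex of $\mathrm{Lk}(\alpha(d))$ determined by $C(d)$ (of dimension $|d|-1$; empty if $d$ is trivial). A diagonal in $X/G$ is a $G$-orbit of diagonals of $X$. Since the action is free, $\alpha,\omega,{}^*,|\cdot|$ descend to diagonals in $X/G$, and the link of $v\in V$ is identified with the link of its image in $X/G$; so for a diagonal $i$ in $X/G$, $\sigma(i)$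 is a simplex in $\mathrm{Lk}(\alpha(i))$. $\mathcal{A}$ is the (finite) set of nontrivial diagonals in $X/G$, and $\mathcal{S}=\mathcal{A}\cup(V/G)$ is the set of all diagonals in $X/G$. For a simplex $\sigma$, $\mathrm{St}(\sigma)$ is the union of all simplices of the link containing $\sigma$ as a face. Normal cube paths: a normal cube path in $X/G$ is a finite sequence $(i_1,\dots,i_m)$ of elements of $\mathcal{A}$ with $\omega(i_k)=\alpha(i_{k+1})$ and $\mathrm{St}(\sigma(i_k^* ))\cap\sigma(i_{k+1})=\emptyset$ for all $1\le k<m$. $\mathcal{L}_{x,y}$ is the set of words $i_1\cdots i_m$ in the free monoid $\mathcal{A}^*$ given by normal cube paths from $x$ to $y$ (including the empty word if $x=y$). Series: $\mathbb{Q}((\mathcal{A}))$ is the ring of formal Laurent series over $\mathbb{Q}$ in noncommuting indeterminates indexed by $\mathcal{A}$, with $a^{-1}$ the formal inverse of $a\in\mathcal{A}$; concretely, formal sums $\sum_w c_w w$ over elements $w$ of the free group on $\mathcal{A}$, with $c_w\in\mathbb{Q}$, such that the exponent sums of the $w$ with $c_w\ne0$ are bounded below and for each integer $m$ only finitely many $w$ of exponent sum $m$ have $c_w\neq 0$. The characteristic series is $\lambda_{x,y}=\sum_{w\in\mathcal{L}_{x,y}}w$. Reciprocal: an automaton accepting $\mathcal{L}_{x,y}$ gives a representation $\lambda_{x,y}=B(I-Q)^{-1}E$; here $Q=Q_+$ is the $\mathcal{S}\times\mathcal{S}$ matrix with $Q_{i,j}=i$ if $i,j\in\mathcal{A}$,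 $\alpha(j)=\omega(i)$ and $\mathrm{St}(\sigma(i^* ))\cap\sigma(j)=\emptyset$; $Q_{i,j}=i$ if $i\in\mathcal{A}$, $j\in V/G$ and $\omega(i)=j$; and $Q_{i,j}=0$ otherwise. $B=B_\alpha$ is the $1\times\mathcal{S}$ row vector with entry $1$ at each $i\in\mathcal{S}$ with $\alpha(i)=x$ and $0$ elsewhere, and $E$ is the $\mathcal{S}\times1$ column vector with entry $1$ at $y$ and $0$ elsewhere. Let $\overline{Q}$ be obtained from $Q$ by replacing each letter $a\in\mathcal{A}$ by $a^{-1}$. The reciprocal exists if $I-\overline{Q}$ is invertible over $\mathbb{Q}((\mathcal{A}))$, and then $\overline{\lambda}_{x,y}=B(I-\overline{Q})^{-1}E$ (a known result says that the reciprocal, when it exists, does not depend on the choice of automaton). Involution: for a word $w=i_1i_2\cdots i_m\in\mathcal{A}^*$ put $w^*=i_1^*i_2^*\cdots i_m^*$ (the order of letters is not reversed), and extend linearly to series; so $\lambda_{x,y}^*=\sum_{w\in\mathcal{L}_{x,y}}w^*$. *)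

(* Defs.v *)
From HB Require Import structures.
From mathcomp Require Import all_boot all_order all_algebra.
From mathcomp Require Import generic_quotient finmap.
From mathcomp Require Import all_classical all_reals all_analysis.

Set Implicit Arguments.
Unset Strict Implicit.
Unset Printing Implicit Defensive.
Import Order.TTheory GRing.Theory Num.Theory.
Import numFieldNormedType.Exports.

Local Open Scope classical_set_scope.
Local Open Scope ring_scope.

Section Cubes.
Variable R : realType.

Definition unit_interval : topologicalType := set_type [set r : R | 0 <= r <= 1].

Lemma unit0_subproof : (0 : R) \in [set r : R | 0 <= r <= 1].
Proof. by rewrite inE /= lexx ler01. Qed.

Lemma unit1_subproof : (1 : R) \in [set r : R | 0 <= r <= 1].
Proof. by rewrite inE /= lexx ler01. Qed.

Definition unit0 : unit_interval := exist _ 0 unit0_subproof.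
Definition unit1 : unit_interval := exist _ 1 unit1_subproof.

Lemma flip_subproof (t : unit_interval) :
  (1 - val t : R) \in [set r : R | 0 <= r <= 1].
Proof.
case: t => r /=; rewrite !inE /= => /andP[r0 r1].
by rewrite subr_ge0 r1 lerBlDr lerDl r0.
Qed.

Definition flip (t : unit_interval) : unit_interval :=
  exist _ (1 - val t) (flip_subproof t).

Lemma flipK : involutive flip.
Proof. by move=> t; apply: val_inj; rewrite /= opprB addrC subrK. Qed.

(* The matrix topology on 'rV is the product topology. *)
Definition cube (n : nat) : topologicalType := 'rV[unit_interval]_n.

Definition cube_interior n (t : cube n) : Prop :=
  forall i, 0 < (val (t ord0 i) : R) < 1.

(* The isometries of [0,1]^m onto a face of [0,1]^n: each coordinate of the
   image is a constant 0 or 1, or a coordinate t_j or 1 - t_j of the source, and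
   each source coordinate is used exactly once.  For m = n these are all the
   isometries of the cube (signed permutations of the coordinates). *)
Variant face_coord (m : nat) :=
  | Fixed of bool
  | Coord of 'I_m & bool.

Definition face_coord_eval m (t : cube m) (c : face_coord m) : unit_interval :=
  match c with
  | Fixed b => if b then unit1 else unit0
  | Coord j b => if b then flip (t ord0 j) else t ord0 j
  end.

Definition face_map m n (e : cube m -> cube n) : Prop :=
  exists2 c : 'I_n -> face_coord m,
    forall j, exists! i, exists b, c i = Coord j b &
    forall t, e t = \row_i face_coord_eval t (c i).

(* The parametrised closed cells of a space made of cubes: [chart n] is the set
   of all isometric parametrisations, by [0,1]^n, of its n-cubes, so that one
   n-cube accounts for 2^n n! charts. *)
Record cubing (T : Type) := Cubing {
  chart : forall n, set (cube n -> T);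
  chart_face : forall m n (e : cube m -> cube n) (f : cube n -> T),
    face_map e -> chart f -> chart (f \o e)
}.

(* X is obtained from cubes by gluing along isometries of faces: it is the
   disjoint union of the open cells, each of which embeds; every face of a cube
   is again one of the cubes ([chart_face]); and X carries the quotient topology
   of the disjoint union of the cubes. *)
Record cube_complex (X : topologicalType) (K : cubing X) : Prop := {
  open_cells_cover : forall x : X, exists n (f : cube n -> X) t,
    [/\ chart K f, cube_interior t & f t = x];
  open_cell_inj : forall n (f : cube n -> X) s t, chart K f ->
    cube_interior s -> cube_interior t -> f s = f t -> s = t;
  open_cells_disjoint : forall m n (f : cube m -> X) (g : cube n -> X) s t,
    chart K f -> chart K g -> cube_interior s -> cube_interior t ->
    f s = g t -> exists2 e : cube m -> cube n, face_map e & f = g \o e;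
  weak_topology : forall U : set X,
    open U <-> forall n (f : cube n -> X), chart K f -> open (f @^-1` U)
}.

Definition simply_connected (X : topologicalType) : Prop :=
  [/\ exists x : X, True,
      forall x y : X, exists p : unit_interval -> X,
        [/\ continuous p, p unit0 = x & p unit1 = y] &
      forall p : unit_interval -> X, continuous p -> p unit0 = p unit1 ->
        exists H : unit_interval * unit_interval -> X,
          [/\ continuous H, forall s, H (s, unit0) = p s,
              forall s, H (s, unit1) = p unit0 &
              forall t, H (unit0, t) = p unit0 /\ H (unit1, t) = p unit0]].

(* Abstract simplicial complexes are sets of finite subsets of a vertex set,
   the empty simplex included. *)
Section Complexes.
Variables (V : choiceType) (L : set (set V)).

Definition simplex_dim (s : set V) : int := #|` fset_set s|%:Z - 1.

Definition complex_dim (d : int) : Prop :=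
  (exists2 s, L s & simplex_dim s = d) /\
  (forall s, L s -> simplex_dim s <= d).

Definition euler_char : int :=
  \sum_(s \in L `\ set0) (-1 : int) ^ (simplex_dim s).

Definition flag : Prop := forall s : set V, finite_set s ->
  (forall u v, s u -> s v -> L [set u; v]) -> L s.

(* The vertices of the star; two simplices of a complex, hence also a star and
   a simplex, meet if and only if they have a common vertex. *)
Definition star (s : set V) : set V := \bigcup_(r in L `&` [set r | s `<=` r]) r.

End Complexes.

Section Links.
Variables (T : choiceType) (K : cubing T).

(* A simplex with m (ordered) vertices of the link of the k-cell f is a
   (k+m)-cube of which f is the face where the last m coordinates vanish. *)
Definition link_simplex k (f : cube k -> T) m (F : cube (k + m) -> T) : Prop :=
  chart K F /\ forall t, F (row_mx t (const_mx unit0)) = f t.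

Definition link_vertex k m (F : cube (k + m) -> T) (i : 'I_m) :
    cube (k + 1) -> T :=
  fun t => F (row_mx (lsubmx t)
    (\row_j if j == i then t ord0 (rshift k ord0) else unit0)).

Definition link k (f : cube k -> T) : set (set (cube (k + 1) -> T)) :=
  [set s | exists m (F : cube (k + m) -> T),
     link_simplex f F /\ s = range (link_vertex F)].

Definition link_simplicial k (f : cube k -> T) : Prop :=
  (forall m (F : cube (k + m) -> T),
     link_simplex f F -> injective (link_vertex F)) /\
  (forall m (F F' : cube (k + m) -> T),
     link_simplex f F -> link_simplex f F' ->
     link_vertex F = link_vertex F' -> F = F').

Definition vertex_chart (v : T) : cube 0 -> T := fun=> v.

Definition vertices : set T := [set v | chart K (vertex_chart v)].

Definition maximal_cell m (f : cube m -> T) : Prop :=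
  chart K f /\
  forall p (F : cube p -> T) (e : cube m -> cube p),
    chart K F -> face_map e -> f = F \o e -> p = m.

Definition eulerian (n : nat) : Prop :=
  [/\ forall k (f : cube k -> T), chart K f -> link_simplicial f,
      forall m (f : cube m -> T), maximal_cell f -> m = n &
      forall k (f : cube k -> T), chart K f ->
        exists2 d, complex_dim (link f) d & euler_char (link f) = 1 + (-1) ^ d].

End Links.

Definition CAT0 (X : topologicalType) (K : cubing X) : Prop :=
  simply_connected X /\
  forall v, vertices K v ->
    link_simplicial K (vertex_chart v) /\ flag (link K (vertex_chart v)).

Section Diagonals.
Variables (T : choiceType) (K : cubing T).

(* A directed diagonal is the segment t |-> f(t, ..., t), f being a chart; as the
   charts include all the reparametrisations by symmetries of the cube, each
   directed diagonal of a cube is of this form. *)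
Definition diagonal_of n (f : cube n -> T) : unit_interval -> T :=
  fun t => f (const_mx t).

Definition nontrivial_diagonals : set (unit_interval -> T) :=
  [set d | exists n (f : cube n.+1 -> T), chart K f /\ d = diagonal_of f].

Definition ddiagonal : choiceType := set_type nontrivial_diagonals.

Definition vertex : choiceType := set_type (vertices K).

Definition dsource (d : ddiagonal) : T := val d unit0.
Definition dtarget (d : ddiagonal) : T := val d unit1.

Lemma dstar_subproof (d : ddiagonal) : val d \o flip \in nontrivial_diagonals.
Proof.
case: d => d /=; rewrite !inE => -[n [f [Kf ->]]].
pose e (t : cube n.+1) : cube n.+1 := \row_i face_coord_eval t (Coord i true).
exists n, (f \o e); split.
  apply: chart_face Kf; exists (fun i => Coord i true) => // j.
  exists j; split; first by exists true.
  by move=> i [b]; case.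
apply/funext => t; rewrite /diagonal_of /=; congr (f _).
by apply/matrixP => z i; rewrite !mxE /= mxE.
Qed.

Definition dstar (d : ddiagonal) : ddiagonal :=
  exist _ (val d \o flip) (dstar_subproof d).

(* The vertex set of the simplex sigma(d) of the link of [dsource d]; the charts
   with diagonal d differ by a permutation of the coordinates. *)
Definition dsimplex (d : ddiagonal) : set (cube (0 + 1) -> T) :=
  [set u | exists m (F : cube (0 + m) -> T),
     [/\ chart K F, val d = diagonal_of F & exists i, u = link_vertex F i]].

Definition normal_step (i j : ddiagonal) : Prop :=
  dtarget i = dsource j /\
  star (link K (vertex_chart (dtarget i))) (dsimplex (dstar i))
    `&` dsimplex j = set0.

Definition normal_path (x y : vertex) (w : seq ddiagonal) : Prop :=
  if w is i :: w' then
    [/\ dsource i = val x, dtarget (last i w') = val y &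
        sorted (fun i j => `[< normal_step i j >]) w]
  else x = y.

End Diagonals.

Section Actions.
Variables (G : groupType) (X : topologicalType).
Local Open Scope group_scope.

Record group_action := GroupAction {
  act :> G -> X -> X;
  act_1 : forall x, act 1%g x = x;
  act_M : forall g h x, act (g * h)%g x = act g (act h x)
}.

Variable a : group_action.

Definition orbit_rel : rel X := fun x y => `[< exists g, a g x = y >].

Lemma orbit_rel_refl : reflexive orbit_rel.
Proof. by move=> x; apply/asboolP; exists 1%g; rewrite act_1. Qed.

Lemma orbit_rel_sym : symmetric orbit_rel.
Proof.
suff h x y : orbit_rel x y -> orbit_rel y x by move=> x y; apply/idP/idP; apply: h.
move=> /asboolP[g <-]; apply/asboolP; exists g^-1%g.
by rewrite -act_M mulVg act_1.
Qed.

Lemma orbit_rel_trans : transitive orbit_rel.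
Proof.
move=> y x z /asboolP[g <-] /asboolP[h <-]; apply/asboolP; exists (h * g)%g.
by rewrite act_M.
Qed.

Canonical orbit_equiv : equiv_rel X :=
  EquivRel orbit_rel orbit_rel_refl orbit_rel_sym orbit_rel_trans.

Definition orbit_space : topologicalType :=
  quotient_topology {eq_quot orbit_equiv}%qT.

Definition orbit_proj (x : X) : orbit_space := (\pi_({eq_quot orbit_equiv}) x)%qT.

Definition free_action : Prop := forall g x, a g x = x -> g = 1%g.

Definition cocompact_action : Prop := compact [set: orbit_space].

Variable K : cubing X.

Definition cellular_action : Prop :=
  forall g n (f : cube n -> X), chart K f -> chart K (a g \o f).

Lemma orbit_cubing_subproof m n (e : cube m -> cube n) (f : cube n -> orbit_space) :
  face_map e -> [set orbit_proj \o h | h in @chart _ K n] f ->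
  [set orbit_proj \o h | h in @chart _ K m] (f \o e).
Proof. by move=> fe [h Kh <-]; exists (h \o e) => //; exact: chart_face. Qed.

(* The cube structure of X/G; the cells of X/G are the orbits of cells of X, and
   under a free action its diagonals are the orbits of diagonals of X. *)
Definition orbit_cubing : cubing orbit_space :=
  Cubing orbit_cubing_subproof.

End Actions.
End Cubes.

(* The free group on A: reduced words in the letters (a, true) = a and
   (a, false) = a^-1. *)
Section FreeGroup.
Variable A : choiceType.

Definition letter_inv (x : A * bool) : A * bool := (x.1, ~~ x.2).

Definition reduced (w : seq (A * bool)) : bool :=
  sorted (fun x y => y != letter_inv x) w.

Record freegroup := FreeGroup { fgword :> seq (A * bool); _ : reduced fgword }.

HB.instance Definition _ := [isSub for fgword].
HB.instance Definition _ := [Choice of freegroup by <:].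

Definition letter_mul (x : A * bool) (w : seq (A * bool)) : seq (A * bool) :=
  if w is y :: w' then if y == letter_inv x then w' else x :: w else [:: x].

Lemma letter_invK : involutive letter_inv.
Proof. by case=> a b; rewrite /letter_inv /= negbK. Qed.

Lemma reduced_behead x w : reduced (x :: w) -> reduced w.
Proof. by case: w => //= y w /andP[]. Qed.

Lemma reduced_letter_mul x w : reduced w -> reduced (letter_mul x w).
Proof.
case: w => //= y w rw; case: eqP => [_|/eqP nxy]; first exact: reduced_behead rw.
by rewrite /= nxy.
Qed.

Lemma letter_mulK x w : reduced w ->
  letter_mul x (letter_mul (letter_inv x) w) = w.
Proof.
case: w => [|y w] /=; first by rewrite eqxx.
rewrite letter_invK; case: eqP => [->|_] /=; last by rewrite eqxx.
by case: w => //= z w /andP[/negPf ->].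
Qed.

Definition word_mul (u v : seq (A * bool)) := foldr letter_mul v u.

Lemma reduced_mul u v : reduced v -> reduced (word_mul u v).
Proof. by move=> rv; elim: u => //= x u IH; apply: reduced_letter_mul. Qed.

Lemma word_mul_letter x v w : reduced v -> reduced w ->
  word_mul (letter_mul x v) w = letter_mul x (word_mul v w).
Proof.
case: v => //= y v rv rw; case: eqP => //= ->.
by rewrite letter_mulK // reduced_mul.
Qed.

Definition word_inv (w : seq (A * bool)) := rev (map letter_inv w).

Lemma reduced_inv w : reduced w -> reduced (word_inv w).
Proof.
rewrite /word_inv /reduced rev_sorted sorted_map; apply: sub_sorted => x y /=.
by rewrite letter_invK; apply: contra => /eqP ->.
Qed.

Definition fg_one : freegroup := @FreeGroup [::] isT.
Definition fg_mul (u v : freegroup) : freegroup :=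
  FreeGroup (reduced_mul u (valP v)).
Definition fg_inv (u : freegroup) : freegroup := FreeGroup (reduced_inv (valP u)).

Lemma fg_mulA : associative fg_mul.
Proof.
move=> u v w; apply: val_inj => /=.
have rv := valP v; have rw := valP w.
elim: (fgword u) => //= x s ->.
by rewrite -word_mul_letter //; apply: reduced_mul.
Qed.

Lemma fg_mul1 : left_id fg_one fg_mul.
Proof. by move=> u; apply: val_inj. Qed.

Lemma fg_mulr1 : right_id fg_one fg_mul.
Proof.
move=> u; apply: val_inj => /=; have := valP u => /=.
elim: (fgword u) => //= x s IH rs; rewrite IH; last exact: reduced_behead rs.
by case: s rs {IH} => //= y s /andP[/negPf ->].
Qed.

Lemma fg_mulVr : left_inverse fg_one fg_inv fg_mul.
Proof.
move=> u; apply: val_inj => /=; have := valP u => /=.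
elim: (fgword u) => //= x s IH rs; rewrite /word_inv /= rev_cons /word_mul.
rewrite foldr_rcons /= letter_invK eqxx; apply: IH; exact: reduced_behead rs.
Qed.

Lemma fg_mulrV : right_inverse fg_one fg_inv fg_mul.
Proof.
have invK u : fg_inv (fg_inv u) = u.
  apply: val_inj; rewrite /= /word_inv map_rev revK -map_comp.
  by rewrite -[RHS]map_id; apply: eq_map => x /=; rewrite letter_invK.
by move=> u; rewrite -{1}[u]invK fg_mulVr.
Qed.

HB.instance Definition _ :=
  isGroup.Build freegroup fg_mulA fg_mul1 fg_mulr1 fg_mulVr fg_mulrV.

Definition fg_letter (a : A) (b : bool) : freegroup :=
  @FreeGroup [:: (a, b)] isT.

Definition fg_of_word (w : seq A) : freegroup :=
  (\prod_(a <- w) fg_letter a true)%g.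

Definition exponent_sum (w : freegroup) : int :=
  \sum_(x <- fgword w) (if x.2 then 1 else -1).

End FreeGroup.

(* Series are coefficient functions; those satisfying [laurent] form the ring
   Q((A)).  Sums over infinite index sets below have finite support whenever
   the series involved are Laurent series. *)
Section Series.
Variable A : choiceType.

Definition nc_series := freegroup A -> rat.

Definition laurent (s : nc_series) : Prop :=
  (exists m : int, forall w, s w != 0 -> m <= exponent_sum w) /\
  (forall m : int, finite_set [set w | s w != 0 /\ exponent_sum w = m]).

Definition smonomial (g : freegroup A) : nc_series := fun w => (w == g)%:R.

Definition szero : nc_series := fun=> 0.
Definition sone : nc_series := smonomial 1%g.
Definition ssub (s t : nc_series) : nc_series := fun w => s w - t w.
Definition sscale (c : rat) (s : nc_series) : nc_series := fun w => c * s w.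

Definition smul (s t : nc_series) : nc_series := fun w =>
  \sum_(p \in [set p : freegroup A * freegroup A | (p.1 * p.2)%g = w])
    (s p.1 * t p.2).

Definition char_series (L : set (seq A)) : nc_series := fun w =>
  \sum_(u \in [set u | L u /\ fg_of_word u = w]) (1 : rat).

(* The linear extension of the letterwise action of f to series in words. *)
Definition smap (f : A -> A) (s : nc_series) : nc_series := fun w =>
  \sum_(u \in [set u : seq A | fg_of_word (map f u) = w]) s (fg_of_word u).

Variable S : choiceType.
Definition smatrix := S -> S -> nc_series.

Definition smx_laurent (M : smatrix) : Prop := forall i j, laurent (M i j).

Definition smx1 : smatrix := fun i j => if i == j then sone else szero.

Definition smx_sub (M N : smatrix) : smatrix := fun i j => ssub (M i j) (N i j).

Definition smx_mul (M N : smatrix) : smatrix := fun i j w =>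
  \sum_(k \in [set: S]) smul (M i k) (N k j) w.

Definition smx_row_mul (B : S -> nc_series) (M : smatrix) : S -> nc_series :=
  fun j w => \sum_(k \in [set: S]) smul (B k) (M k j) w.

Definition smx_row_col (B E : S -> nc_series) : nc_series := fun w =>
  \sum_(k \in [set: S]) smul (B k) (E k) w.

Definition smx_inverse (M N : smatrix) : Prop :=
  [/\ smx_laurent N, smx_mul M N = smx1 & smx_mul N M = smx1].

Definition smx_invertible (M : smatrix) : Prop := exists N, smx_inverse M N.

(* The inverse of M, and an unspecified value if M is not invertible. *)
Definition smx_inv (M : smatrix) : smatrix :=
  xget smx1 [set N | smx_inverse M N].

End Series.

Section Reciprocal.
Variables (R : realType) (T : choiceType) (K : cubing R T).

Local Notation A := (ddiagonal K).

(* All the diagonals: the nontrivial ones and the vertices. *)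
Definition state : choiceType := (A + vertex K)%type.

Definition state_source (s : state) : T :=
  match s with inl i => dsource i | inr v => val v end.

(* The transition matrix of the automaton of normal cube paths, with the series
   [letter i] in place of the letter i: the matrix Q is the case of the monomials
   i, and Qbar that of the monomials i^-1. *)
Definition transition (letter : A -> nc_series A) : smatrix A state := fun s s' =>
  match s, s' with
  | inl i, inl j => if `[< normal_step i j >] then letter i else @szero A
  | inl i, inr v => if `[< dtarget i = val v >] then letter i else @szero A
  | inr _, _ => @szero A
  end.

Definition Qbar : smatrix A state :=
  transition (fun i => smonomial (fg_letter i false)).

Definition initial_row (x : vertex K) : state -> nc_series A := fun s =>
  if `[< state_source s = val x >] then @sone A else @szero A.

Definition final_col (y : vertex K) : state -> nc_series A := fun s =>
  if s == inr y then @sone A else @szero A.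

Definition I_sub_Qbar : smatrix A state := smx_sub (@smx1 A state) Qbar.

(* The path series is B (I - Q)^-1 E, with B the row [initial_row x] and E the
   column [final_col y]; its reciprocal is B (I - Qbar)^-1 E. *)
Definition reciprocal_exists : Prop := smx_invertible I_sub_Qbar.

Definition reciprocal (x y : vertex K) : nc_series A :=
  smx_row_col (smx_row_mul (initial_row x) (smx_inv I_sub_Qbar)) (final_col y).

Definition path_series (x y : vertex K) : nc_series A :=
  char_series [set w | normal_path x y w].

Definition path_series_star (x y : vertex K) : nc_series A :=
  smap (@dstar R T K) (path_series x y).

End Reciprocal.

(* Main.v *)
(** Write [h a b] for "[a] and [b] have the same source and the star of
    [sigma(a)] does not meet [sigma(b)]", and [e a = (-1)^|a|].  Inclusion-exclusion
    over the simplices of a flag complex, together with the Euler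
    characteristics of the links of the cells, shows that the matrix [e h e] is
    the inverse of [h].  As [Qbar = D^-1 P h] on the nontrivial diagonals, where
    [D] is the diagonal matrix of the letters and [P] the permutation [a |-> a^*],
    this gives [I - Qbar = - Qbar (I - e h e P D)], whose last factor is inverted
    by a geometric series in the words of normal cube paths, with positive
    letters.  Summing over the diagonals issued from a vertex produces the Euler
    characteristic of its link, hence the sign [(-1)^n]. *)
Require Import Defs.
From HB Require Import structures.
From mathcomp Require Import all_boot all_order all_algebra.

Set Implicit Arguments.
Unset Strict Implicit.
Unset Printing Implicit Defensive.
Import Order.TTheory GRing.Theory Num.Theory.
Local Open Scope ring_scope.

(** * Flag complexes *)

(** The power [Qbar^k] has exponent sum [-k], so [I - Qbar] cannot be inverted in the Laurent ring
    by summing these powers: the factor [Qbar] has to be taken out and itself inverted, which is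
    what the identity [h e h = e] allows. The nontrivial diagonals issued from a vertex are the
    nonempty simplices of its link, and the trivial diagonal is the empty simplex. The identities
    are proved over all simplices and then restricted. The empty simplex drops out where its star,
    the whole link, has to avoid a nonempty simplex; elsewhere it accounts for the terms [-1] that
    the vertex states of the automaton compensate. As [smx_inv] is a choice, the explicit inverse
    must also be unique among Laurent matrices. The geometric input comes from two spaces: the
    simplicial links and Euler characteristics are those of X/G, whereas flagness is that of X and
    is carried down by lifting edges. Compactness of X/G gives a finite alphabet because every set
    of cell centers is closed. *)

Section FlagComplex.
Variables (R : comNzRingType) (U : finType).
Implicit Types (s t r k : {set U}) (L : {set {set U}}).

Local Notation sgn s := ((-1) ^+ #|s : {set U}| : R).

Lemma sgn_toggle u s : u \notin s -> sgn (u |: s) = - sgn s.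
Proof. by move=> us; rewrite cardsU1 us exprS mulN1r. Qed.

Lemma sgn_sqr s : sgn s * sgn s = 1.
Proof. by rewrite -expr2 -exprM mulnC exprM sqrrN !expr1n. Qed.

(** Adding or removing [u] is a sign-reversing involution on the sets satisfying [P]. *)
Lemma sum_sgn_toggle (P : pred {set U}) u :
  (forall s, u \notin s -> P (u |: s) = P s) -> \sum_(s : {set U} | P s) sgn s = 0.
Proof.
move=> Pu; rewrite (bigID (fun s => u \in s)) /=.
rewrite (reindex_onto (fun s => u |: s) (fun s => s :\ u)) /=; last first.
  by move=> s /andP[_ us]; rewrite setD1K.
rewrite (eq_bigl (fun s : {set U} => P s && (u \notin s))); last first.
  move=> s; rewrite setU11 andbT; case: (boolP (u \in s)) => us /=.
    rewrite andbF; apply/negP => /andP[_ /eqP e].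
    by move: us; rewrite -e !inE eqxx.
  by rewrite Pu // setU1K // eqxx.
rewrite -big_split big1 // => s /andP[_ us].
by rewrite sgn_toggle //= addNr.
Qed.

(** If [s] is properly inside [t], an element of [t] outside [s] can be toggled. This is Möbius
    inversion in the Boolean lattice. *)
Lemma sum_sgn_interval s t :
  \sum_(r : {set U} | (s \subset r) && (r \subset t)) sgn r = (s == t)%:R * sgn s.
Proof.
have [st|nst] := boolP (s \subset t); last first.
  rewrite big_pred0 => [|r]; last first.
    by apply: contraNF nst => /andP[]; apply: subset_trans.
  by case: eqP nst => [->|_]; rewrite ?subxx // mul0r.
have [<-|nE] := eqVneq s t.
  rewrite mul1r (big_pred1 s) // => r.
  by rewrite /= -eqEsubset eq_sym.
rewrite mul0r.
have /properP[_ [u ut us]] : s \proper t by rewrite properEneq nE.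
apply: (sum_sgn_toggle (u := u)) => r ur.
rewrite subUset sub1set ut /=; congr (_ && _).
apply/idP/idP => [/subsetP sr|/subset_trans]; last by apply; exact: subsetUr.
apply/subsetP => x xs; have := sr x xs.
by rewrite !inE => /predU1P[xu|//]; rewrite -xu xs in us.
Qed.

Lemma sum_sgn_subset t :
  \sum_(r : {set U} | r \subset t) sgn r = (t == set0)%:R.
Proof.
rewrite eq_sym -[RHS]mulr1 -[X in _ * X](expr0 (-1)) -(cards0 U).
rewrite -sum_sgn_interval; apply: eq_bigl => r.
by rewrite sub0set.
Qed.

Variables (L : {set {set U}}) (n : nat).
Hypothesis L_sub : forall s t, t \in L -> s \subset t -> s \in L.
Hypothesis L_flag : forall s,
  (forall u v, u \in s -> v \in s -> [set u; v] \in L) -> s \in L.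
(** The Eulerian condition on the link of [s], which has dimension [n - #|s| - 1]: its Euler
    characteristic is [1 - (-1)^(n - #|s|)], the empty simplex of the link cancels the 1, and
    adjoining [s] multiplies every sign by that of [s]. *)
Hypothesis L_euler : forall s, s \in L ->
  \sum_(t in L | s \subset t) sgn t = (-1) ^+ n.

(* The vertices of the star of s; [star_meets s t] says that this star meets t. *)
Definition star_verts s := [set u | u |: s \in L].

Definition star_meets s t := t :&: star_verts s != set0.

(** By flagness only the mixed pairs of vertices matter, and a vertex in [star_verts s] is joined to
    every vertex of [s]. *)
Lemma flag_join s t : s \in L -> t \in L -> (t :|: s \in L) = (t \subset star_verts s).
Proof.
move=> sL tL; apply/idP/idP => [tsL|/subsetP tN].
  apply/subsetP => u ut; rewrite inE; apply: L_sub tsL _.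
  by rewrite setSU // sub1set.
have mem2 u v : u \in s -> v \in t -> [set u; v] \in L.
  move=> us vt; have := tN v vt; rewrite inE => h; apply: L_sub h _.
  by rewrite subUset !sub1set !inE us eqxx orbT.
apply: L_flag => u v; rewrite !inE => /orP[ut|us] /orP[vt|vs].
- by apply: L_sub tL _; rewrite subUset !sub1set ut.
- by rewrite setUC mem2.
- by rewrite mem2.
- by apply: L_sub sL _; rewrite subUset !sub1set us.
Qed.

(* By flagness, r joins s to a simplex exactly when r lies in [star_verts s]. *)
Lemma not_meetsE s t : s \in L -> t \in L ->
  (~~ star_meets s t)%:R = \sum_(r : {set U} | (r \subset t) && (r :|: s \in L)) sgn r.
Proof.
move=> sL tL; rewrite negbK -sum_sgn_subset; apply: eq_bigl => r.
rewrite subsetI; case: (boolP (r \subset t)) => //= rt.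
by rewrite flag_join // (L_sub tL).
Qed.

(** A vertex of [r] can be toggled in [k] without changing the union, so only the empty [r]
    survives; what remains is the Euler relation at the empty simplex. *)
Lemma sum_sgn_join r : r \in L ->
  \sum_(k : {set U} | r :|: k \in L) sgn k = (r == set0)%:R * (-1) ^+ n.
Proof.
move=> rL; have [->|/set0Pn[u ur]] := eqVneq r set0.
  rewrite mul1r -(L_euler (L_sub rL (sub0set _))).
  by apply: eq_bigl => k; rewrite set0U sub0set andbT.
rewrite mul0r; apply: (sum_sgn_toggle (u := u)) => k uk.
by rewrite setUCA; congr (_ \in L); apply/setUidPr; rewrite sub1set inE ur.
Qed.

(** Once the indicator is expanded over the [r] inside [t] and the sums are exchanged,
    [sum_sgn_join] kills every term but [r = set0]. *)
Lemma sum_not_meets t : t \in L ->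
  \sum_(k in L | ~~ star_meets k t) sgn k = (-1) ^+ n.
Proof.
move=> tL; rewrite big_mkcondr /=.
under eq_bigr => k kL.
  rewrite -mulrb -[sgn k *+ _]mulr_natr not_meetsE // mulr_sumr.
  rewrite (eq_bigl (fun r : {set U} => (r \subset t) && (r :|: k \in L))) //.
over.
rewrite (exchange_big_dep (fun r : {set U} => r \subset t)) /=; last first.
  by move=> k r _ /andP[].
under eq_bigr => r rt.
  rewrite -mulr_suml (eq_bigl (fun k : {set U} => r :|: k \in L)); last first.
    move=> k; rewrite rt /=; case: (boolP (r :|: k \in L)); rewrite ?andbF //.
    by move=> rk; rewrite (L_sub rk) // subsetUr.
  rewrite sum_sgn_join ?(L_sub tL) // -mulrA.
over.
rewrite (bigD1 set0) ?sub0set //= eqxx cards0 expr0 mulr1 mul1r.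
by rewrite big1 ?addr0 // => r /andP[_ /negPf ->]; rewrite mul0r.
Qed.

(* Expand the indicator of avoiding the star of s over the p in
   [k :&: star_verts s]; the Euler characteristic of the link of p turns the
   sum over k into a sum over simplices joinable to s, where a vertex of s
   outside r can be toggled. *)
Lemma sum_sgn_join_avoid s r : s \in L -> r \in L ->
  \sum_(k : {set U} | (r :|: k \in L) && ~~ star_meets s k) sgn k = (s \subset r)%:R.
Proof.
move=> sL rL.
(* A vertex of [r] outside the star of [s] can be toggled in [k]: neither the union with [r] nor the
   trace on the star changes. It also excludes that [s] lies in [r], since [r] is a simplex. *)
have [rN|/subsetPn[u ur uN]] := boolP (r \subset star_verts s); last first.
  have -> : (s \subset r) = false.
    apply: contraNF uN => sr; rewrite inE; apply: L_sub rL _.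
    by rewrite subUset sub1set ur.
  apply: (sum_sgn_toggle (u := u)) => k uk; congr (_ && ~~ _).
    by congr (_ \in L); rewrite setUCA; apply/setUidPr; rewrite sub1set inE ur.
  rewrite /star_meets setIUl (_ : [set u] :&: _ = set0) ?set0U //.
  by apply/setP => v; rewrite !inE; case: eqP => // ->; move: uN; rewrite inE => /negPf.
transitivity (\sum_(k : {set U} | r :|: k \in L)
    \sum_(p : {set U} | p \subset k :&: star_verts s) sgn k * sgn p).
  rewrite big_mkcondr; apply: eq_bigr => k _.
  rewrite -mulr_sumr sum_sgn_subset /star_meets negbK.
  by case: eqP; rewrite ?mulr1 ?mulr0.
rewrite (exchange_big_dep (fun p : {set U} => p \subset star_verts s)) /=; last first.
  by move=> k p _; rewrite subsetI => /andP[].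
transitivity (\sum_(p : {set U} | [&& r \subset p, p \in L & p \subset star_verts s])
    (-1) ^+ n * sgn p).
  rewrite [RHS](eq_bigl (fun p : {set U} => (p \subset star_verts s) && ((r \subset p) && (p \in L)))).
    rewrite [RHS]big_mkcondr; apply: eq_bigr => p pN.
    rewrite -mulr_suml; set S := (X in X * _ = _).
    suff -> : S = if (r \subset p) && (p \in L) then (-1) ^+ n else 0.
      by case: ifP; rewrite ?mul0r.
    rewrite {}/S.
    have [rp|/subsetPn[u ur up]] /= := boolP (r \subset p); last first.
      apply: (sum_sgn_toggle (u := u)) => k uk.
      congr (_ && _).
        by congr (_ \in L); rewrite setUCA; apply/setUidPr; rewrite sub1set inE ur.
      rewrite !subsetI pN !andbT; apply/idP/idP => [/subsetP sr|/subset_trans];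
        last by apply; exact: subsetUr.
      apply/subsetP => x xs; have := sr x xs.
      by rewrite !inE => /predU1P[xu|//]; rewrite -xu xs in up.
    rewrite (eq_bigl (fun k : {set U} => (k \in L) && (p \subset k))); last first.
      move=> k; rewrite subsetI pN andbT.
      have [pk|] := boolP (p \subset k); rewrite ?andbF // !andbT.
      by congr (_ \in L); apply/setUidPr; exact: subset_trans pk.
    have [pL|pL] := boolP (p \in L); first by rewrite L_euler.
    rewrite big_pred0 // => k; apply: contraNF pL => /andP[kL].
    exact: L_sub.
  by move=> p; rewrite andbA andbC.
rewrite -mulr_sumr.
rewrite (eq_bigl (fun p : {set U} => (r \subset p) && (p :|: s \in L))); last first.
  move=> p; congr (_ && _); have [pL|pL] /= := boolP (p \in L).
    by rewrite flag_join.
  by apply/esym; apply: contraNF pL => /L_sub; apply; exact: subsetUl.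
have [sr|/subsetPn[u us ur]] := boolP (s \subset r); last first.
  rewrite (sum_sgn_toggle (u := u)) ?mulr0 // => k uk; congr (_ && _).
    apply/idP/idP => [/subsetP sr|/subset_trans]; last by apply; exact: subsetUr.
    apply/subsetP => x xs; have := sr x xs.
    by rewrite !inE => /predU1P[xu|//]; rewrite -xu xs in ur.
  by congr (_ \in L); rewrite -setUA; apply/setUidPr; rewrite sub1set inE us orbT.
rewrite (eq_bigl (fun p : {set U} => (p \in L) && (r \subset p))); last first.
  move=> p; rewrite andbC; have [rp|] := boolP (r \subset p); rewrite ?andbF // !andbT.
  by congr (_ \in L); apply/setUidPl; exact: subset_trans rp.
(* The Euler relation is used a second time, now at [r]; the two signs [(-1)^n] multiply to 1. *)
by rewrite L_euler // -expr2 -exprM mulnC exprM sqrrN !expr1n.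
Qed.

(** This is [h e h = e] over all simplices, the empty one included. Expanding the second indicator
    over the [r] inside [t] leaves, by [sum_sgn_join_avoid], the alternating sum over the interval
    from [s] to [t]. *)
Lemma sum_not_meets2 s t : s \in L -> t \in L ->
  \sum_(k in L | ~~ star_meets s k && ~~ star_meets k t) sgn k = (s == t)%:R * sgn s.
Proof.
move=> sL tL; rewrite -(sum_sgn_interval s t).
rewrite (eq_bigl (fun k : {set U} => ((k \in L) && ~~ star_meets s k) && ~~ star_meets k t)); last first.
  by move=> k; rewrite andbA.
rewrite big_mkcondr /=.
under eq_bigr => k /andP[kL _].
  rewrite -mulrb -[sgn k *+ _]mulr_natr not_meetsE // mulr_sumr.
over.
rewrite (exchange_big_dep (fun r : {set U} => r \subset t)) /=; last first.
  by move=> k r _ /andP[].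
rewrite [RHS](eq_bigl (fun r : {set U} => (r \subset t) && (s \subset r))); last first.
  by move=> r; rewrite andbC.
rewrite [RHS]big_mkcondr; apply: eq_bigr => r rt.
rewrite -mulr_suml (eq_bigl (fun k : {set U} => (r :|: k \in L) && ~~ star_meets s k)).
  rewrite (sum_sgn_join_avoid sL (L_sub tL rt)).
  by case: ifP; rewrite ?mul1r ?mul0r.
move=> k; rewrite rt /=; case: (boolP (r :|: k \in L)); rewrite ?andbF //= ?andbT.
by move=> rk; rewrite (L_sub rk) // subsetUr.
Qed.

End FlagComplex.

(* Imported only now: classical_sets shadows the names of several finset lemmas
   used above. *)
From mathcomp Require Import generic_quotient finmap.
From mathcomp Require Import all_classical all_reals all_analysis.
From mathcomp Require Import ring lra.
Import numFieldNormedType.Exports.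
Local Open Scope classical_set_scope.
Local Open Scope ring_scope.

(** * Series in the free group *)

Section PositiveWords.
Variable A : choiceType.
Implicit Types (g w : freegroup A) (u : seq A) (a : A).

Definition positive g := all snd (fgword g).
Definition letters g : seq A := map fst (fgword g).

Lemma fgword_of_word u : fgword (fg_of_word u) = [seq (a, true) | a <- u].
Proof.
elim: u => [|a u IH]; first by rewrite /fg_of_word big_nil.
rewrite /fg_of_word big_cons /= -/(fg_of_word u) IH.
by case: u {IH} => //= b u; case: eqP => // -[].
Qed.

Lemma positive_of_word u : positive (fg_of_word u).
Proof. by rewrite /positive fgword_of_word all_map; apply/allP. Qed.

Lemma lettersK : cancel (@fg_of_word A) letters.
Proof. by move=> u; rewrite /letters fgword_of_word -map_comp map_id. Qed.

Lemma of_wordK g : positive g -> fg_of_word (letters g) = g.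
Proof.
move=> pg; apply: val_inj; rewrite /= fgword_of_word -map_comp.
move: pg; rewrite /positive; elim: (fgword g) => //= -[a b] s IH /= /andP[b1 /IH ->].
by rewrite /= in b1; rewrite b1.
Qed.

Lemma of_word_cons a u :
  fg_of_word (a :: u) = (fg_letter a true * fg_of_word u)%g.
Proof. by rewrite /fg_of_word big_cons. Qed.

Lemma of_word_rcons a u :
  fg_of_word (rcons u a) = (fg_of_word u * fg_letter a true)%g.
Proof. by rewrite /fg_of_word -cats1 big_cat /= big_seq1. Qed.

Lemma letterV a : (fg_letter a false)^-1%g = fg_letter a true.
Proof. exact: val_inj. Qed.

Lemma of_word_eq1 u : (fg_of_word u == 1%g) = (u == [::]).
Proof.
have <- : fg_of_word [::] = 1%g :> freegroup A by rewrite /fg_of_word big_nil.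
by rewrite (can_eq lettersK).
Qed.

Lemma exponent_sum_of_word u : exponent_sum (fg_of_word u) = (size u)%:Z.
Proof.
rewrite /exponent_sum fgword_of_word big_map /=.
by elim: u => [|a u IH]; rewrite ?big_nil // big_cons IH intS.
Qed.

Lemma exponent_sum_letterN a g :
  exponent_sum (fg_letter a false * g)%g = exponent_sum g - 1.
Proof.
rewrite /exponent_sum /=; case: (fgword g) => [|y s] /=.
  by rewrite big_seq1 big_nil sub0r.
case: eqP => [->|_]; rewrite !big_cons /=; last by rewrite addrC.
by rewrite addrAC subrr add0r.
Qed.

End PositiveWords.

Section SeriesProducts.

Lemma fsum_seq (T : choiceType) (B : set T) (r : seq T) (f : T -> rat) :
  uniq r -> (forall i, i \in r -> B i) -> (forall i, B i -> i \notin r -> f i = 0) ->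
  \sum_(i \in B) f i = \sum_(i <- r) f i.
Proof.
move=> ur rB f0; rewrite (fsbigE r) // [LHS]big_seq_cond [RHS]big_seq.
apply: eq_bigl => i; case: (boolP (i \in r)) => //= /rB Bi.
by rewrite mem_set.
Qed.

Lemma fsum_sum (T1 T2 : choiceType) (r1 : seq T1) (r2 : seq T2)
    (f : (T1 + T2)%type -> rat) :
  uniq r1 -> uniq r2 -> (forall i, i \in r1) -> (forall i, i \in r2) ->
  \sum_(i \in [set: (T1 + T2)%type]) f i =
  \sum_(i <- r1) f (inl i) + \sum_(i <- r2) f (inr i).
Proof.
move=> u1 u2 m1 m2; rewrite (fsum_seq (r := map inl r1 ++ map inr r2)) //.
- by rewrite big_cat !big_map.
- rewrite cat_uniq !map_inj_uniq ?u1 ?u2 ?andbT //=; try by move=> ? ? [].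
  by apply/hasP => -[_ /mapP[j _ ->] /mapP[]].
- move=> [i|i] _; rewrite mem_cat ?(map_f inl) //.
  by rewrite (map_f inr) ?orbT.
Qed.

Variable A : choiceType.
Implicit Types (g w : freegroup A) (s t : nc_series A).

(** The convolution runs over the infinitely many factorisations of [w]; a finite support on one
    side lists those that can contribute, whatever the other factor is. *)
Lemma smul_suppl (r : seq (freegroup A)) s t w : uniq r ->
  (forall g, g \notin r -> s g = 0) ->
  smul s t w = \sum_(g <- r) s g * t (g^-1 * w)%g.
Proof.
move=> ur sr; rewrite /smul (fsum_seq (r := [seq (g, (g^-1 * w)%g) | g <- r])).
- by rewrite big_map.
- by rewrite map_inj_uniq // => g h [].
- by move=> p /mapP[g _ ->] /=; rewrite mulVKg.
- move=> [g h] /= ghw gh; rewrite sr ?mul0r //; apply: contra gh => gr.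
  by apply/mapP; exists g => //; rewrite -ghw mulKg.
Qed.

Lemma smul_suppr (r : seq (freegroup A)) s t w : uniq r ->
  (forall g, g \notin r -> t g = 0) ->
  smul s t w = \sum_(g <- r) s (w * g^-1)%g * t g.
Proof.
move=> ur tr; rewrite /smul (fsum_seq (r := [seq ((w * g^-1)%g, g) | g <- r])).
- by rewrite big_map.
- by rewrite map_inj_uniq // => g h [].
- by move=> p /mapP[g _ ->] /=; rewrite mulgVK.
- move=> [h g] /= ghw gh; rewrite tr ?mulr0 //; apply: contra gh => gr.
  by apply/mapP; exists g => //; rewrite -ghw mulgK.
Qed.

Lemma smul_condl (b : bool) s w :
  smul (if b then @sone A else @szero A) s w = b%:R * s w.
Proof.
rewrite (smul_suppl (r := [:: 1%g])) //.
  rewrite big_seq1 invg1 mul1g; congr (_ * _).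
  by case: b; rewrite // /sone /smonomial eqxx.
by move=> g; rewrite inE; case: b => //; rewrite /sone /smonomial => /negPf ->.
Qed.

Lemma smul_condr (b : bool) s w :
  smul s (if b then @sone A else @szero A) w = b%:R * s w.
Proof.
rewrite (smul_suppr (r := [:: 1%g])) //.
  rewrite big_seq1 invg1 mulg1 mulrC; congr (_ * _).
  by case: b; rewrite // /sone /smonomial eqxx.
by move=> g; rewrite inE; case: b => //; rewrite /sone /smonomial => /negPf ->.
Qed.

(** The left factor has the shape of an entry of [I_sub_Qbar]: a Kronecker delta minus at most one
    inverse letter. As [g] is not the unit, the two monomials do not overlap. *)
Lemma smul_binl (b c : bool) g s w : g != 1%g ->
  smul (ssub (if b then @sone A else @szero A)
     (if c then smonomial g else @szero A)) s w =
  b%:R * s w - c%:R * s (g^-1 * w)%g.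
Proof.
move=> g1; rewrite (smul_suppl (r := [:: 1%g; g])); first last.
- move=> h; rewrite !inE negb_or => /andP[/negPf h1 /negPf hg].
  by case: b; case: c; rewrite /ssub /sone /szero /smonomial ?h1 ?hg ?subr0.
- by rewrite /= inE eq_sym g1.
rewrite big_cons big_seq1 invg1 mul1g /ssub -mulNr; congr (_ * _ + _ * _).
  by case: b; case: c; rewrite /sone /szero /smonomial ?eqxx 1?eq_sym ?(negPf g1) ?subr0.
by case: b; case: c; rewrite /sone /szero /smonomial ?eqxx ?(negPf g1) ?sub0r ?subr0.
Qed.

Lemma smul_binr (b c : bool) g s w : g != 1%g ->
  smul s (ssub (if b then @sone A else @szero A)
     (if c then smonomial g else @szero A)) w =
  b%:R * s w - c%:R * s (w * g^-1)%g.
Proof.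
move=> g1; rewrite (smul_suppr (r := [:: 1%g; g])); first last.
- move=> h; rewrite !inE negb_or => /andP[/negPf h1 /negPf hg].
  by case: b; case: c; rewrite /ssub /sone /szero /smonomial ?h1 ?hg ?subr0.
- by rewrite /= inE eq_sym g1.
rewrite big_cons big_seq1 invg1 mulg1 /ssub -mulNr ![s _ * _]mulrC.
congr (_ * _ + _ * _).
  by case: b; case: c; rewrite /sone /szero /smonomial ?eqxx 1?eq_sym ?(negPf g1) ?subr0.
by case: b; case: c; rewrite /sone /szero /smonomial ?eqxx ?(negPf g1) ?sub0r ?subr0.
Qed.

End SeriesProducts.

Lemma finite_words (A : choiceType) n :
  finite_set [set: A] -> finite_set [set u : seq A | size u = n].
Proof.
move=> finA; elim: n => [|n IH].
  by apply: sub_finite_set (finite_set1 [::]) => u /size0nil.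
apply: sub_finite_set (finite_image2 cons finA IH) => -[//|a u] /= [un].
by exists a => //; exists u.
Qed.

(** The exponent sum of a positive word is its length, and a finite alphabet has finitely many words
    of each length. *)
Lemma laurent_positive (A : choiceType) (s : nc_series A) :
  finite_set [set: A] -> (forall w, s w != 0 -> positive w) -> laurent s.
Proof.
move=> finA sp; split.
  by exists 0 => w /sp /of_wordK <-; rewrite exponent_sum_of_word.
move=> m; apply: sub_finite_set
  (finite_image (@fg_of_word A) (finite_words `|m|%N finA)).
move=> w [/sp pw <-]; exists (letters w); last exact: of_wordK.
by rewrite /= -{2}(of_wordK pw) exponent_sum_of_word.
Qed.

(** * Inverting the transition matrix of an abstract automaton *)

Section Reciprocity.
Variables (A V : choiceType).
Hypotheses (finA : finite_set [set: A]) (finV : finite_set [set: V]).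
Variables (step : rel A) (src tgt : A -> V -> bool) (star : A -> A).
Variable e : A -> rat.

Local Notation rA := (enum_fset (fset_set [set: A])).
Local Notation rV := (enum_fset (fset_set [set: V])).

Hypothesis starK : involutive star.
Hypothesis src_star : forall a v, src (star a) v = tgt a v.
Hypothesis e_star : forall a, e (star a) = e a.
Hypothesis e_sqr : forall a, e a * e a = 1.
(** With [h a b = step (star a) b] this reads [h e h = e], and the next hypothesis reads
    [h e src = - src]; the minus sign is the contribution of the empty simplex, which is not among
    the [k]. *)
Hypothesis sum_step_step : forall a b,
  \sum_(k <- rA) (step a k)%:R * e k * (step (star k) b)%:R
  = (star a == b)%:R * e a.
Hypothesis sum_step_src : forall a v,
  \sum_(k <- rA) (step a k)%:R * e k * (src k v)%:R = - (tgt a v)%:R.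

Let S : choiceType := (A + V)%type.

Definition letter_matrix : smatrix A S := fun s s' =>
  match s, s' with
  | inl i, inl j => if step i j then smonomial (fg_letter i false) else @szero A
  | inl i, inr v => if tgt i v then smonomial (fg_letter i false) else @szero A
  | inr _, _ => @szero A
  end.

Let M := smx_sub (@smx1 A S) letter_matrix.

(** A word is admissible exactly when its letterwise image under [star] follows [step]. This is the
    transition relation of the matrix [h P D]. *)
Definition adm : rel A := fun c d => step (star c) (star d).

(* The words read from the state a along admissible transitions, each weighted
   by the value of f at its last letter. *)
Definition path_sum (f : A -> rat) (a : A) : nc_series A := fun w =>
  if positive w && path adm a (letters w) then f (last a (letters w)) else 0.

Lemma path_sum_word f a u :
  path_sum f a (fg_of_word u) = (path adm a u)%:R * f (last a u).
Proof.
rewrite /path_sum positive_of_word lettersK /=.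
by case: ifP; rewrite ?mul1r ?mul0r.
Qed.

Lemma path_sum0 f a w : ~~ positive w -> path_sum f a w = 0.
Proof. by rewrite /path_sum => /negPf ->. Qed.

(** By [sum_step_step], the sum over [k] cancels all words whose first letter differs from [i], and
    leaves [e i] on the others. The extra term concerns [w = i^-1], the only non-positive [w] that
    contributes. *)
Lemma path_sum_left f i w :
  \sum_(k <- rA) (step i k)%:R * e k * path_sum f k (fg_letter i true * w)%g =
  (fg_letter i true * w == 1)%g%:R *
    (\sum_(k <- rA) (step i k)%:R * e k * f k) + e i * path_sum f i w.
Proof.
have [pw|nw] := boolP (positive w).
  rewrite -(of_wordK pw) -of_word_cons of_word_eq1 /= mul0r add0r.
  under eq_bigr => k _ do rewrite path_sum_word /= -mulnb natrM !mulrA.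
  rewrite -!mulr_suml sum_step_step eqxx mul1r path_sum_word !mulrA.
  by [].
rewrite (path_sum0 _ _ nw) mulr0 addr0.
have [pg|ng] := boolP (positive (fg_letter i true * w)%g); last first.
  rewrite big1 => [|k _]; last by rewrite path_sum0 // mulr0.
  case: eqP => [g1|_]; last by rewrite mul0r.
  by move: ng; rewrite g1.
move: (letters _) (of_wordK pg) => [|c u] gE; rewrite -gE.
  rewrite of_word_eq1 eqxx mul1r; apply: eq_bigr => k _.
  by rewrite path_sum_word /= mul1r.
rewrite of_word_eq1 mul0r.
under eq_bigr => k _ do rewrite path_sum_word /= -mulnb natrM !mulrA.
rewrite -!mulr_suml sum_step_step (can_eq starK).
case: eqP => [ic|_]; last by rewrite !mul0r.
move: gE nw; rewrite -ic of_word_cons => /mulgI <-.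
by rewrite positive_of_word.
Qed.

(** A nonempty word ending at [k] is a word followed by an admissible transition to [k]; the
    subtracted term is the empty word, which ends at [k] when [a = k]. *)
Lemma path_sum_right a k w :
  path_sum (fun b => (b == k)%:R) a (w * fg_letter k true)%g
    - ((w * fg_letter k true == 1)%g && (a == k))%:R
  = path_sum (fun b => (adm b k)%:R) a w.
Proof.
have [pw|nw] := boolP (positive w).
  rewrite -(of_wordK pw) -of_word_rcons of_word_eq1 !path_sum_word.
  rewrite rcons_path last_rcons eqxx mulr1 -mulnb natrM -size_eq0 size_rcons.
  by rewrite subr0.
rewrite (path_sum0 _ _ nw).
have [pg|ng] := boolP (positive (w * fg_letter k true)%g); last first.
  rewrite path_sum0 //; case: eqP => [g1|_]; last by rewrite subr0.
  by move: ng; rewrite g1.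
move: (letters _) (of_wordK pg); case/lastP => [|u c] gE; rewrite -gE.
  by rewrite of_word_eq1 path_sum_word /= mul1r subrr.
rewrite of_word_eq1 path_sum_word last_rcons -size_eq0 size_rcons subr0.
case: eqP => [ck|_]; last by rewrite mulr0.
move: gE nw; rewrite ck of_word_rcons => /mulIg <-.
by rewrite positive_of_word.
Qed.

Lemma path_sum_lin (c : A -> rat) (f : A -> A -> rat) a w :
  \sum_(k <- rA) c k * path_sum (f k) a w =
  path_sum (fun b => \sum_(k <- rA) c k * f k b) a w.
Proof.
rewrite /path_sum; case: ifP => // _; rewrite big1 // => k _.
by rewrite mulr0.
Qed.

Lemma mem_rA k : k \in rA.
Proof. by rewrite in_fset_set // inE. Qed.

Lemma mem_rV v : v \in rV.
Proof. by rewrite in_fset_set // inE. Qed.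

Lemma uniq_rA : uniq rA. Proof. exact: fset_uniq. Qed.

Lemma uniq_rV : uniq rV. Proof. exact: fset_uniq. Qed.

Lemma sum_delta (T : eqType) (r : seq T) (x : T) (f : T -> rat) :
  uniq r -> x \in r -> \sum_(k <- r) (x == k)%:R * f k = f x.
Proof.
move=> ur xr; rewrite (bigD1_seq x) //= eqxx mul1r big1 ?addr0 // => k.
by rewrite eq_sym => /negPf ->; rewrite mul0r.
Qed.

Lemma sum_star (f : A -> rat) :
  \sum_(k <- rA) f (star k) = \sum_(k <- rA) f k.
Proof.
rewrite -[LHS](big_map star xpredT); apply: perm_big; apply: uniq_perm.
- by rewrite map_inj_uniq ?uniq_rA //; exact: inv_inj.
- exact: uniq_rA.
by move=> k; rewrite mem_rA -[k]starK map_f ?mem_rA.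
Qed.

(* On the nontrivial diagonals, [I - Qbar = - Qbar (I - e h e P D)] with
   [h a b = step (star a) b], so the inverse is
   [- \sum_(k >= 1) (e h e P D)^k = - e (\sum_(k >= 1) (h P D)^k) e]. *)
Definition inverse_matrix : smatrix A S := fun s s' =>
  match s, s' with
  | inl a, inl b => fun w => - (e a * e b) *
      (path_sum (fun c => (c == b)%:R) a w - ((w == 1%g) && (a == b))%:R)
  | inl a, inr v => fun w => e a * path_sum (fun c => (src c v)%:R) a w
  | inr _, inl _ => @szero A
  | inr v, inr v' => if v == v' then @sone A else @szero A
  end.

Local Notation N := inverse_matrix.

Lemma letter_neq1 (i : A) b : fg_letter i b != 1%g.
Proof. by []. Qed.

Lemma mul_left (L : smatrix A S) i j w : smx_mul M L (inl i) j w =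
  L (inl i) j w
  - (\sum_(k <- rA) (step i k)%:R * L (inl k) j (fg_letter i true * w)%g
     + \sum_(v <- rV) (tgt i v)%:R * L (inr v) j (fg_letter i true * w)%g).
Proof.
rewrite /smx_mul (fsum_sum _ uniq_rA uniq_rV mem_rA mem_rV).
under eq_bigr => k _ do
  rewrite /M /smx_sub /= smul_binl ?letter_neq1 // letterV (inj_eq (@inl_inj A V)).
under [X in _ + X = _]eq_bigr => v _ do
  rewrite /M /smx_sub /= (smul_binl false) ?letter_neq1 // letterV mul0r sub0r.
by rewrite sumrB sum_delta ?uniq_rA ?mem_rA // sumrN -addrA -opprD.
Qed.

Lemma mul_right_l (L : smatrix A S) s b w : smx_mul L M s (inl b) w =
  L s (inl b) w
  - \sum_(k <- rA) (step k b)%:R * L s (inl k) (w * fg_letter k true)%g.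
Proof.
rewrite /smx_mul (fsum_sum _ uniq_rA uniq_rV mem_rA mem_rV).
under eq_bigr => k _ do
  rewrite /M /smx_sub /= smul_binr ?letter_neq1 // letterV (inj_eq (@inl_inj A V)) eq_sym.
under [X in _ + X = _]eq_bigr => v _ do
  rewrite /M /smx_sub /= (smul_binr false false _ _ (letter_neq1 b true)) !mul0r subr0.
by rewrite [X in _ + X]big1 // addr0 sumrB sum_delta ?uniq_rA ?mem_rA.
Qed.

Lemma ssub0 (s : nc_series A) : ssub s (@szero A) = s.
Proof. by apply/funext => w; rewrite /ssub subr0. Qed.

Lemma mul_right_r (L : smatrix A S) s v w : smx_mul L M s (inr v) w =
  L s (inr v) w
  - \sum_(k <- rA) (tgt k v)%:R * L s (inl k) (w * fg_letter k true)%g.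
Proof.
rewrite /smx_mul (fsum_sum _ uniq_rA uniq_rV mem_rA mem_rV).
under eq_bigr => k _ do
  rewrite /M /smx_sub /= (smul_binr false) ?letter_neq1 // letterV mul0r sub0r.
under [X in _ + X = _]eq_bigr => v' _ do
  rewrite /M /smx_sub /= ssub0 smul_condr (inj_eq (@inr_inj A V)) eq_sym.
by rewrite sum_delta ?uniq_rV ?mem_rV // sumrN addrC.
Qed.

Lemma mul_row_inr (L : smatrix A S) v s w :
  smx_mul M L (inr v) s w = L (inr v) s w.
Proof.
rewrite /smx_mul (fsum_sum _ uniq_rA uniq_rV mem_rA mem_rV).
under eq_bigr => k _ do
  rewrite /M /smx_sub /= ssub0 (smul_condl false) mul0r.
rewrite big1 // add0r.
under eq_bigr => v' _ do
  rewrite /M /smx_sub /= ssub0 smul_condl (inj_eq (@inr_inj A V)).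
by rewrite sum_delta ?uniq_rV ?mem_rV.
Qed.

Lemma inverse_matrix_right : smx_mul M N = @smx1 A S.
Proof.
apply/funext => -[i|v]; apply/funext => s; apply/funext => w; last first.
  by rewrite mul_row_inr; case: s => // v' /=; rewrite /smx1 (inj_eq (@inr_inj A V)).
rewrite mul_left; case: s => [b|v] /=.
  rewrite [X in - (_ + X)]big1 ?addr0 => [|v _]; last by rewrite mulr0.
  set g := (fg_letter i true * w)%g.
  have -> : \sum_(k <- rA) (step i k)%:R * (- (e k * e b) *
      (path_sum (fun c => (c == b)%:R) k g - ((g == 1%g) && (k == b))%:R)) =
    - e b * (\sum_(k <- rA) (step i k)%:R * e k * path_sum (fun c => (c == b)%:R) k g
      - (g == 1%g)%:R * \sum_(k <- rA) (step i k)%:R * e k * (k == b)%:R).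
    rewrite mulr_sumr -sumrB mulr_sumr; apply: eq_bigr => k _.
    by rewrite -mulnb natrM; ring.
  (* The subtracted unit terms are the boundary term of [path_sum_left]; the path sums then cancel
     and only [e i * e b] at the unit is left, which is 1 when [i = b]. *)
  rewrite path_sum_left (addrC (_ * _) (e i * _)) addrK /smx1 (inj_eq (@inl_inj A V)).
  have [ib|_] := eqVneq i b; last by rewrite andbF /szero /= mulr0n; ring.
  by rewrite ib andbT /sone /smonomial -[RHS]mul1r -(e_sqr b); ring.
have sumV : \sum_(v' <- rV) (tgt i v')%:R *
    (if v' == v then @sone A else @szero A) (fg_letter i true * w)%g =
  (tgt i v)%:R * (fg_letter i true * w == 1)%g%:R.
  rewrite -(sum_delta (fun v' => (tgt i v')%:R * _) uniq_rV (mem_rV v)).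
  apply: eq_bigr => v' _; rewrite eq_sym; case: eqP => _.
    by rewrite mul1r.
  by rewrite /szero mulr0 mul0r.
rewrite sumV //; set g := (fg_letter i true * w)%g.
under eq_bigr => k _ do rewrite mulrA.
(* By [sum_step_src] the boundary term is [- tgt], which cancels the contribution of the vertex
   states. *)
by rewrite path_sum_left sum_step_src /smx1 /=; rewrite /szero; ring.
Qed.

(** Letters are now appended at the end, and [path_sum_lin] moves the sum over the last state into
    the weight of the path. Reindexing this sum by [star] brings it to the form of [sum_step_step]
    or [sum_step_src]. *)
Lemma inverse_matrix_left : smx_mul N M = @smx1 A S.
Proof.
apply/funext => s; apply/funext => -[b|v]; apply/funext => w; last first.
  rewrite mul_right_r; case: s => [a|v'] /=; last first.
    rewrite big1 ?subr0 => [|k _]; last by rewrite mulr0.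
    by rewrite /smx1 (inj_eq (@inr_inj A V)).
  have -> : \sum_(k <- rA) (tgt k v)%:R * (- (e a * e k) *
      (path_sum (fun c => (c == k)%:R) a (w * fg_letter k true)%g
        - ((w * fg_letter k true == 1)%g && (a == k))%:R)) =
    - e a * \sum_(k <- rA) ((tgt k v)%:R * e k) *
      path_sum (fun c => (adm c k)%:R) a w.
    rewrite mulr_sumr; apply: eq_bigr => k _; rewrite path_sum_right; ring.
  rewrite path_sum_lin /smx1 /= /szero -[e a * _]opprK -mulNr -mulrN -mulrBr.
  rewrite -[RHS](mulr0 (- e a)); congr (_ * _).
  rewrite /path_sum; case: ifP => _; last by rewrite oppr0 subr0.
  set c := last _ _; apply/eqP; rewrite -opprD oppr_eq0 addrC addr_eq0; apply/eqP.
  have <- : tgt (star c) v = src c v by rewrite -src_star starK.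
  rewrite -sum_step_src -[LHS]sum_star.
  by apply: eq_bigr => k _; rewrite e_star /adm -src_star !starK; ring.
rewrite mul_right_l; case: s => [a|v'] /=; last first.
  by rewrite big1 ?subr0 // => k _; rewrite mulr0.
have -> : \sum_(k <- rA) (step k b)%:R * (- (e a * e k) *
    (path_sum (fun c => (c == k)%:R) a (w * fg_letter k true)%g
      - ((w * fg_letter k true == 1)%g && (a == k))%:R)) =
  - e a * \sum_(k <- rA) ((step k b)%:R * e k) *
    path_sum (fun c => (adm c k)%:R) a w.
  rewrite mulr_sumr; apply: eq_bigr => k _; rewrite path_sum_right; ring.
rewrite path_sum_lin.
have -> : (fun c => \sum_(k <- rA) (step k b)%:R * e k * (adm c k)%:R) =
    (fun c => e b * (c == b)%:R).
  apply/funext => c; rewrite -sum_star.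
  transitivity (\sum_(k <- rA) (step (star c) k)%:R * e k * (step (star k) b)%:R).
    by apply: eq_bigr => k _; rewrite e_star /adm starK; ring.
  by rewrite sum_step_step starK e_star; case: eqP => [->|_]; rewrite /= ?mulr1n ?mulr0n; ring.
have -> : path_sum (fun c => e b * (c == b)%:R) a w =
    e b * path_sum (fun c => (c == b)%:R) a w.
  by rewrite /path_sum; case: ifP; rewrite ?mulr0.
rewrite /smx1 (inj_eq (@inl_inj A V)).
have [->|_] := eqVneq a b; last by rewrite andbF /szero /= mulr0n; ring.
by rewrite andbT /sone /smonomial -[RHS]mul1r -(e_sqr b); ring.
Qed.

Lemma inverse_matrix_positive s s' w : N s s' w != 0 -> positive w.
Proof.
apply: contraNT => nw.
have w1 : (w == 1%g) = false by apply: contraNF nw => /eqP ->.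
case: s s' => [a|v] [b|v'] /=; rewrite ?path_sum0 ?w1 /= ?subr0 ?mulr0 //.
by case: (v == v'); rewrite /sone /smonomial ?w1.
Qed.

Lemma inverse_matrix_laurent : smx_laurent N.
Proof.
by move=> s s'; apply: laurent_positive => // w; exact: inverse_matrix_positive.
Qed.

(* The difference D of two right inverses satisfies [i D_i = \sum_k step i k D_k].
   Inverting the matrix step expresses D in terms of its values on elements of
   smaller exponent sum, which eventually vanish. *)
Lemma right_inverse_unique (L : smatrix A S) :
  smx_laurent L -> smx_mul M L = @smx1 A S -> L = N.
Proof.
move=> lL ML; have ML' := etrans ML (esym inverse_matrix_right).
have Lr v j : L (inr v) j = N (inr v) j.
  apply/funext => w; have := congr1 (fun m => m (inr v) j w) ML'.
  by rewrite /= !mul_row_inr.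
apply/funext => -[i|v]; apply/funext => j; last exact: Lr.
pose D k w := L (inl k) j w - N (inl k) j w.
have Dstep k w : D k w =
    \sum_(l <- rA) (step k l)%:R * D l (fg_letter k true * w)%g.
  have := congr1 (fun m => m (inl k) j w) ML'; rewrite !mul_left => /eqP.
  rewrite subr_eq => /eqP; rewrite /D => ->.
  have -> : \sum_(v <- rV) (tgt k v)%:R * L (inr v) j (fg_letter k true * w)%g =
      \sum_(v <- rV) (tgt k v)%:R * N (inr v) j (fg_letter k true * w)%g.
    by apply: eq_bigr => v _; rewrite Lr.
  under [RHS]eq_bigr => l _ do rewrite mulrBr.
  by rewrite sumrB; ring.
have Dinv b g : e b * D b g = \sum_(k <- rA) (step (star b) k)%:R * e k *
    D (star k) (fg_letter (star k) false * g)%g.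
  under [RHS]eq_bigr => k _ do rewrite Dstep -letterV mulVKg mulr_sumr.
  rewrite exchange_big /=.
  transitivity (\sum_(l <- rA) (b == l)%:R * e (star b) * D l g).
    under eq_bigr => l _ do rewrite -mulrA.
    by rewrite sum_delta ?uniq_rA ?mem_rA // e_star.
  apply: eq_bigr => l _; rewrite -{1}[b]starK -sum_step_step mulr_suml.
  by apply: eq_bigr => k _; rewrite mulrA.
have /choice[m mP] k : exists m, forall w, L (inl k) j w != 0 -> m <= exponent_sum w.
  by have [[m mP] _] := lL (inl k) j; exists m.
(* A common lower bound of the exponents in the entries [L (inl k) j]; it is also at most 0, the
   lower bound for [N], whose entries are supported on positive words. *)
pose m0 := - \sum_(k <- rA) `|m k|.
have Dlow k g : exponent_sum g < m0 -> D k g = 0.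
  move=> gm; rewrite /D; apply/eqP; rewrite subr_eq0.
  have -> : L (inl k) j g = 0.
    apply/eqP; apply: contraTT gm => /mP; rewrite -leNgt; apply: le_trans.
    rewrite /m0 lerNl (le_trans (ler_norm _)) // normrN.
    rewrite (bigD1_seq k) ?mem_rA ?uniq_rA //= lerDl.
    by apply: sumr_ge0 => ? _; exact: normr_ge0.
  rewrite eq_sym; apply: contraTT gm => /inverse_matrix_positive /of_wordK <-.
  rewrite -leNgt exponent_sum_of_word (@le_trans _ _ 0) // oppr_le0.
  by apply: sumr_ge0 => ? _; exact: normr_ge0.
suff D0 p k g : exponent_sum g < m0 + p%:Z -> D k g = 0.
  apply/funext => w; apply/eqP; rewrite -subr_eq0; apply/eqP.
  apply: (D0 (`|exponent_sum w - m0|.+1)); rewrite intS.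
  rewrite -ltrBlDl abszE (le_lt_trans (ler_norm _)) //.
  by rewrite ltrDr.
elim: p => [|p IH] in k g *; first by rewrite addr0; exact: Dlow.
move=> gp; rewrite -[LHS]mul1r -(e_sqr k) -mulrA Dinv big1 ?mulr0 // => l _.
rewrite IH ?mulr0 // exponent_sum_letterN ltrBlDr.
by rewrite -addrA (addrC p%:Z) -intS.
Qed.

(** The value of [smx_inv] is picked by choice and becomes known only through uniqueness. *)
Lemma smx_inv_letter_matrix : smx_inv M = N.
Proof.
rewrite /smx_inv; apply: xget_unique.
  by split; [exact: inverse_matrix_laurent|exact: inverse_matrix_right|
    exact: inverse_matrix_left].
by move=> L [lL ML _]; exact: right_inverse_unique.
Qed.

Lemma letter_matrix_invertible : smx_invertible M.
Proof.
exists N; split; [exact: inverse_matrix_laurent|exact: inverse_matrix_right|].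
exact: inverse_matrix_left.
Qed.

Variable sgn : rat.
(** The Euler relations at a vertex, [sgn] standing for [(-1)^n]. Here the omitted empty simplex
    would contribute nothing, since its star meets [b]; in [sum_src_src] it would contribute 1,
    whence [sgn - 1]. *)
Hypothesis sum_src_step : forall v b,
  \sum_(k <- rA) (src k v)%:R * e k * (step (star k) b)%:R
  = sgn * (src b v)%:R.
Hypothesis sum_src_src : forall v v',
  \sum_(k <- rA) (src k v)%:R * e k * (src k v')%:R
  = (v == v')%:R * (sgn - 1).

(** Only the column of [y] in the inverse matters. Summing over the initial diagonals [k] collapses,
    by [sum_src_step], to a condition on the first letter; the right-hand side says that the word
    becomes a normal path from [x] to [y] under [star]. *)
Lemma reciprocity (x y : V) (B : S -> bool) w :
  (forall a, B (inl a) = src a x) -> (forall v, B (inr v) = (v == x)) ->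
  smx_row_col
    (smx_row_mul (fun s => if B s then @sone A else @szero A) (smx_inv M))
    (fun s => if s == inr y then @sone A else @szero A) w =
  sgn * (positive w && (if letters w is c :: u then
    [&& src (star c) x, path adm c u & src (last c u) y] else x == y))%:R.
Proof.
move=> Bl Br; rewrite smx_inv_letter_matrix /smx_row_col.
rewrite (fsum_sum _ uniq_rA uniq_rV mem_rA mem_rV).
under eq_bigr => k _ do rewrite /= (smul_condr false) mul0r.
rewrite big1 // add0r.
under eq_bigr => v _ do rewrite smul_condr (inj_eq (@inr_inj A V)) eq_sym.
rewrite sum_delta ?uniq_rV ?mem_rV // /smx_row_mul.
rewrite (fsum_sum _ uniq_rA uniq_rV mem_rA mem_rV).
under eq_bigr => k _ do rewrite smul_condl Bl /= mulrA.
under [X in _ + X = _]eq_bigr => v _ do rewrite smul_condl Br eq_sym.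
rewrite sum_delta ?uniq_rV ?mem_rV //=.
have [pw|nw] /= := boolP (positive w); last first.
  rewrite big1 => [|k _]; last by rewrite path_sum0 // mulr0.
  case: eqP => _; last by rewrite mulr0 addr0.
  rewrite /sone /smonomial mulr0 add0r; case: eqP => // w1.
  by move: nw; rewrite w1.
move: (letters w) (of_wordK pw) => u <- {w pw}.
under eq_bigr => k _ do rewrite path_sum_word.
have -> : (if x == y then @sone A else @szero A) (fg_of_word u) =
    (x == y)%:R * (u == [::])%:R.
  by case: eqP => _; rewrite ?mul0r ?mul1r // /sone /smonomial of_word_eq1.
(* For the empty word the state of the vertex [x] adds the 1 that [sum_src_src] subtracts; for the
   other words it contributes nothing. *)
case: u => [|c u] /=.
  under eq_bigr => k _ do rewrite mul1r.
  by rewrite sum_src_src; ring.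
under eq_bigr => k _ do rewrite -mulnb natrM !mulrA.
by rewrite -!mulr_suml sum_src_step mulr0 addr0 -!mulnb !natrM !mulrA.
Qed.

End Reciprocity.

(** * Faces of cubes and links *)

Section CubeMaps.
Variable R : realType.
Local Notation I := (unit_interval R).

Definition const_cube n (r : I) : cube R n := const_mx r.

Lemma midpoint_subproof : (2^-1 : R) \in [set r : R | 0 <= r <= 1].
Proof. by rewrite inE /=; lra. Qed.

Lemma third_subproof : (3^-1 : R) \in [set r : R | 0 <= r <= 1].
Proof. by rewrite inE /=; lra. Qed.

Definition midpoint : I := exist _ 2^-1 midpoint_subproof.
(* A point of the main diagonal which no reflection of the cube fixes, whereas the
   midpoint is fixed by all the symmetries. *)
Definition third : I := exist _ 3^-1 third_subproof.

Lemma flip_midpoint : flip midpoint = midpoint.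
Proof. by apply: val_inj => /=; lra. Qed.

Lemma flip_third : flip third <> third.
Proof. by move=> /(congr1 val) /=; lra. Qed.

Lemma interior_midpoint n : cube_interior (const_cube n midpoint).
Proof. by move=> i; rewrite mxE /=; lra. Qed.

Lemma interior_third n : cube_interior (const_cube n third).
Proof. by move=> i; rewrite mxE /=; lra. Qed.

(* The face of the n-cube spanned by the edges at the origin with directions in
   the range of q. *)
Definition sel m n (q : 'I_m -> 'I_n) (t : cube R m) : cube R n :=
  \row_i (if [pick j | q j == i] is Some j then t ord0 j else unit0 R).

Lemma selE m n (q : 'I_m -> 'I_n) t j :
  injective q -> sel q t ord0 (q j) = t ord0 j.
Proof.
move=> qi; rewrite mxE; case: pickP => [j' /eqP /qi -> //|/(_ j)].
by rewrite eqxx.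
Qed.

Lemma sel_out m n (q : 'I_m -> 'I_n) t i :
  (forall j, q j != i) -> sel q t ord0 i = unit0 R.
Proof. by move=> qn; rewrite mxE; case: pickP => // j /idPn; rewrite qn. Qed.

Lemma sel_face m n (q : 'I_m -> 'I_n) : injective q -> face_map (sel q).
Proof.
move=> qi; exists (fun i => if [pick j | q j == i] is Some j then Coord j false
                            else Fixed m false); last first.
  by move=> t; apply/rowP => i; rewrite !mxE; case: pickP.
move=> j; exists (q j); split.
  exists false; case: pickP => [j' /eqP /qi -> //|/(_ j)].
  by rewrite eqxx.
by move=> i [b]; case: pickP => // j' /eqP <- [->].
Qed.

Lemma sel_comp m n p (q : 'I_m -> 'I_n) (q' : 'I_n -> 'I_p) t :
  injective q -> injective q' -> sel q' (sel q t) = sel (q' \o q) t.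
Proof.
move=> qi qi'; have qqi : injective (q' \o q) by exact: inj_comp.
apply/rowP => i; have [j /eqP <-|ni] := pickP (fun j => q' j == i); last first.
  rewrite !sel_out // => j; first by rewrite -[_ == i]/(q' (q j) == i) ni.
  by rewrite ni.
rewrite selE //; have [l /eqP <-|nj] := pickP (fun l => q l == j).
  by rewrite selE // -[q' (q l)]/((q' \o q) l) selE.
rewrite !sel_out // => l; last by rewrite nj.
by rewrite /= (inj_eq qi') nj.
Qed.

Lemma sel_const m n (q : 'I_m -> 'I_n) : sel q (const_cube m (unit0 R)) = const_cube n (unit0 R).
Proof. by apply/rowP => i; rewrite !mxE; case: pickP => // j _; rewrite mxE. Qed.

Lemma sel_const_sq n (q : 'I_n -> 'I_n) r :
  injective q -> sel q (const_cube n r) = const_cube n r.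
Proof.
move=> qi; apply/rowP => i; have /codomP[j ->] : i \in codom q.
  by rewrite (inj_card_onto qi).
by rewrite selE // !mxE.
Qed.

Lemma sel_ord1 (q : 'I_1 -> 'I_1) t : sel q t = t.
Proof.
apply/rowP => i; have {1}-> : i = q i by rewrite [LHS]ord1 [RHS]ord1.
by rewrite selE // => j k _; rewrite !ord1.
Qed.

Definition signed_perm n (p : 'I_n -> 'I_n) (b : 'I_n -> bool) (t : cube R n) :
    cube R n :=
  \row_i (if b i then flip (t ord0 (p i)) else t ord0 (p i)).

Lemma face_map_leq m n (e : cube R m -> cube R n) : face_map e -> (m <= n)%N.
Proof.
move=> [c /choice[q qP] _]; have qi : injective q.
  by move=> i j qij; have [[b]] := qP i; have [[b']] := qP j; rewrite qij => -> _ [].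
by rewrite -[m]card_ord -[n]card_ord; exact: leq_card qi.
Qed.

Lemma face_map_signed n (e : cube R n -> cube R n) : face_map e ->
  exists p b, injective p /\ e = signed_perm p b.
Proof.
move=> [c /choice[q qP] eE]; have qi : injective q.
  by move=> i j qij; have [[b]] := qP i; have [[b']] := qP j; rewrite qij => -> _ [].
have [p pq qp] := injF_bij qi.
have /choice[b bP] i : exists b, c i = Coord (p i) b.
  by have [[b cb] _] := qP (p i); exists b; rewrite -cb qp.
exists p, b; split; first exact: can_inj qp.
by apply/funext => t; rewrite eE; apply/rowP => i; rewrite !mxE bP.
Qed.

Lemma signed_perm_face n (p : 'I_n -> 'I_n) b :
  injective p -> face_map (signed_perm p b).
Proof.
move=> pi; exists (fun i => Coord (p i) (b i)); last first.
  by move=> t; apply/rowP => i; rewrite !mxE.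
have [q qp pq] := injF_bij pi; move=> j; exists (q j); split.
  by exists (b (q j)); rewrite pq.
by move=> i [b' []] <- _; rewrite qp.
Qed.

Lemma signed_perm_midpoint n (p : 'I_n -> 'I_n) b :
  signed_perm p b (const_cube n midpoint) = const_cube n midpoint.
Proof. by apply/rowP => i; rewrite !mxE flip_midpoint if_same. Qed.

Lemma signed_perm_third n (p : 'I_n -> 'I_n) b : injective p ->
  signed_perm p b (const_cube n third) = const_cube n third ->
  exists2 q, injective q & signed_perm p b = sel q.
Proof.
move=> pi /rowP bE; have [q qp pq] := injF_bij pi.
have b0 i : b i = false.
  have := bE i; rewrite !mxE; case: (b i) => // /flip_third [].
(* [signed_perm] reads its [i]-th coordinate at [p i], whereas [sel] writes the [j]-th coordinate at
   [q j]: hence the inverse permutation. *)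
exists q; first exact: can_inj pq.
apply/funext => t; apply/rowP => i; rewrite -[in RHS](qp i) selE ?mxE ?b0 //.
exact: can_inj pq.
Qed.

(** The face is cut out by the coordinates of [t] equal to 0 or 1; the other coordinates,
    enumerated, parametrise it. *)
Lemma cube_interior_face n (t : cube R n) :
  exists m (e : cube R m -> cube R n) s,
    [/\ face_map e, cube_interior s & e s = t].
Proof.
pose P := [pred i | 0 < (val (t ord0 i) : R) < 1].
pose c i : face_coord #|P| :=
  if [pick j : 'I_#|P| | enum_val j == i] is Some j then Coord j false
  else Fixed #|P| (t ord0 i == unit1 R).
exists #|P|, (fun s => \row_i face_coord_eval s (c i)), (\row_j t ord0 (enum_val j)).
split.
- exists c => // j; exists (enum_val j); rewrite /c; split.
    exists false; case: pickP => [j' /eqP /enum_val_inj -> //|/(_ j)].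
    by rewrite eqxx.
  by move=> i [b]; case: pickP => // j' /eqP <- [->].
- by move=> j; rewrite mxE; have := enum_valP j; rewrite inE.
apply/rowP => i; rewrite mxE /c; case: pickP => /= [j /eqP <-|ni].
  by rewrite mxE.
have : i \notin P.
  by apply/negP => iP; have := ni (enum_rank_in iP i); rewrite enum_rankK_in ?eqxx.
rewrite inE negb_and -!leNgt => ti.
case: eqP => [-> //|nt]; apply: val_inj; move: ti nt => /=.
case: (t ord0 i) => r /= rI ti nt; have := rI; rewrite inE /= => /andP[r0 r1].
apply/eqP; rewrite eq_le r0 /=.
case/orP: ti => // r1'; case: nt; apply: val_inj => /=; apply/eqP.
by rewrite eq_le r1.
Qed.

End CubeMaps.

Section Cells.
Variables (R : realType) (T : choiceType) (K : cubing R T).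

Definition origin n (F : cube R n -> T) : T := F (const_cube n (unit0 R)).

Definition edge n (F : cube R n -> T) (i : 'I_n) : cube R 1 -> T :=
  F \o sel (fun _ : 'I_1 => i).

Lemma inj_ord1 (X : Type) (f : 'I_1 -> X) : injective f.
Proof. by move=> i j _; rewrite [i]ord1 [j]ord1. Qed.

Lemma comp_sel m n p (F : cube R p -> T) (q : 'I_m -> 'I_n) (q' : 'I_n -> 'I_p) :
  injective q -> injective q' -> (F \o sel q') \o sel q = F \o sel (q' \o q).
Proof. by move=> qi qi'; apply/funext => t /=; rewrite sel_comp. Qed.

Lemma edge_sel m n (F : cube R n -> T) (q : 'I_m -> 'I_n) j :
  injective q -> edge (F \o sel q) j = edge F (q j).
Proof. by move=> qi; rewrite /edge comp_sel //; exact: inj_ord1. Qed.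

Lemma origin_sel m n (F : cube R n -> T) (q : 'I_m -> 'I_n) :
  origin (F \o sel q) = origin F.
Proof. by rewrite /origin /= sel_const. Qed.

Lemma chart_sel m n (F : cube R n -> T) (q : 'I_m -> 'I_n) :
  injective q -> chart K F -> chart K (F \o sel q).
Proof. by move=> qi; apply: chart_face; exact: sel_face. Qed.

Lemma chart_edge n (F : cube R n -> T) i : chart K F -> chart K (edge F i).
Proof. by apply: chart_sel; exact: inj_ord1. Qed.

Lemma cube0 (s t : cube R 0) : s = t.
Proof. by apply/rowP => -[]. Qed.

Lemma vertex_chart_origin n (F : cube R n -> T) :
  chart K F -> chart K (@vertex_chart R T (origin F)).
Proof.
move=> KF; have ->: @vertex_chart R T (origin F) = F \o sel (ffun0 (card_ord 0)).
  by apply/funext => t; rewrite /vertex_chart -(origin_sel F (ffun0 (card_ord 0)))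
    /origin (cube0 t (const_cube 0 (unit0 R))).
by apply: chart_sel KF => -[].
Qed.

(** Keeps the first [k] directions and sends the last one to the [i]-th link direction; vertices of
    links thus become faces at the origin, handled by the composition rules of [sel]. *)
Definition link_index (k m : nat) (i : 'I_m) (j : 'I_(k + 1)) : 'I_(k + m) :=
  match fintype.split j with inl a => lshift m a | inr _ => rshift k i end.

Lemma link_index_l (k m : nat) (i : 'I_m) (a : 'I_k) : link_index i (lshift 1 a) = lshift m a.
Proof. by rewrite /link_index -[lshift 1 a]/(unsplit (inl a)) unsplitK. Qed.

Lemma link_index_r (k m : nat) (i : 'I_m) : link_index i (rshift k ord0) = rshift k i.
Proof. by rewrite /link_index -[rshift k ord0]/(unsplit (inr ord0)) unsplitK. Qed.

Lemma link_index_inj (k m : nat) (i : 'I_m) : injective (link_index (k := k) i).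
Proof.
move=> a b; rewrite -[a]fintype.splitK -[b]fintype.splitK.
case: (fintype.split a) (fintype.split b) => a' [] b' /=.
- by rewrite !link_index_l => /lshift_inj ->.
- by rewrite [b']ord1 link_index_l link_index_r => /eqP; rewrite eq_lrshift.
- by rewrite [a']ord1 link_index_l link_index_r => /eqP; rewrite eq_rlshift.
- by rewrite [a']ord1 [b']ord1.
Qed.

Lemma link_vertex_sel k m (F : cube R (k + m) -> T) i :
  link_vertex F i = F \o sel (link_index i).
Proof.
have qi := @link_index_inj k m i.
apply/funext => t /=; congr (F _); apply/rowP => j.
rewrite -[j]fintype.splitK; case: (fintype.split j) => a /=.
  by rewrite row_mxEl mxE -(link_index_l i) selE.
rewrite row_mxEr mxE; case: eqP => [->|ai]; first by rewrite -(@link_index_r k m i) selE.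
rewrite sel_out // => b; rewrite -[b]fintype.splitK.
case: (fintype.split b) => c /=; first by rewrite link_index_l eq_lrshift.
by rewrite [c]ord1 link_index_r (inj_eq (@rshift_inj _ _)); apply/eqP => /esym.
Qed.

Lemma link_vertex_edge m (F : cube R m -> T) i :
  link_vertex (F : cube R (0 + m) -> T) i = edge F i.
Proof.
rewrite link_vertex_sel /edge; congr (F \o sel _); apply/funext => j.
rewrite -[j](@fintype.splitK 0 1); case: (@fintype.split 0 1 j) => [[]//|c] /=.
by rewrite [c]ord1 link_index_r; exact: ord_inj.
Qed.

Lemma link_simplex_origin m (F : cube R m -> T) v :
  link_simplex K (@vertex_chart R T v) (F : cube R (0 + m) -> T) <->
  chart K F /\ origin F = v.
Proof.
have row0 (t : cube R 0) : row_mx t (const_cube m (unit0 R)) = const_cube m (unit0 R).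
  apply/rowP => j; rewrite -[j]fintype.splitK; case: (fintype.split j) => [[]//|a] /=.
  rewrite (row_mxEr t) !mxE //.
split=> -[KF F0]; split=> //.
  by have := F0 (const_mx (unit0 R)); rewrite row0.
by move=> t; rewrite -[const_mx _]/(const_cube m _) row0.
Qed.

Lemma link_vertexP v (s : set (cube R 1 -> T)) :
  link K (@vertex_chart R T v) s <->
  exists m (F : cube R m -> T), [/\ chart K F, origin F = v & s = range (edge F)].
Proof.
have rE m (F : cube R m -> T) :
    range (link_vertex (F : cube R (0 + m) -> T)) = range (edge F).
  by congr image; apply/funext => i; exact: link_vertex_edge.
split=> [[m [F [/link_simplex_origin[KF F0] ->]]]|[m [F [KF F0 ->]]]].
  by exists m, F; split.
by exists m, F; split; [exact/link_simplex_origin|rewrite rE].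
Qed.

End Cells.

(** The conditions of [cube_complex] on the open cells, without the topology: they are shared by X
    and X/G, so that what is deduced from them applies to both. *)
Record disjoint_cells (R : realType) (T : Type) (K : cubing R T) : Prop := {
  cell_inj : forall n (f : cube R n -> T) s t, chart K f ->
    cube_interior s -> cube_interior t -> f s = f t -> s = t;
  cell_disjoint : forall m n (f : cube R m -> T) (g : cube R n -> T) s t,
    chart K f -> chart K g -> cube_interior s -> cube_interior t ->
    f s = g t -> exists2 e : cube R m -> cube R n, face_map e & f = g \o e
}.

Section DisjointCells.
Variables (R : realType) (T : choiceType) (K : cubing R T).
Hypothesis hK : disjoint_cells K.

Lemma same_cell_dim m n (f : cube R m -> T) (g : cube R n -> T) s t :
  chart K f -> chart K g -> cube_interior s -> cube_interior t ->
  f s = g t -> m = n.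
Proof.
move=> Kf Kg si ti fg; apply/eqP; rewrite eqn_leq.
have [e /face_map_leq -> _] := cell_disjoint hK Kf Kg si ti fg.
by have [e' /face_map_leq -> _] := cell_disjoint hK Kg Kf ti si (esym fg).
Qed.

Lemma interior_signed_perm n (p : 'I_n -> 'I_n) b (t : cube R n) :
  cube_interior t -> cube_interior (signed_perm p b t).
Proof.
move=> ti i; rewrite mxE; have := ti (p i).
by case: (b i) => //=; case: (t ord0 (p i)) => r /= _; lra.
Qed.

Lemma same_cell_map n (f g : cube R n -> T) s t :
  chart K f -> chart K g -> cube_interior s -> cube_interior t ->
  f s = g t -> exists p b,
    [/\ injective p, f = g \o signed_perm p b & signed_perm p b s = t].
Proof.
move=> Kf Kg si ti fg.
have [e /face_map_signed[p [b [pi eE]]] fE] := cell_disjoint hK Kf Kg si ti fg.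
exists p, b; split; rewrite -?eE //.
apply: (cell_inj hK Kg _ ti); last by rewrite -fg fE.
by rewrite eE; exact: interior_signed_perm.
Qed.

(** The point lies in the open cell, so both charts parametrise the same cube, and no reflection
    fixes it. Hence a directed diagonal determines its cube and its chart up to a permutation of the
    coordinates. *)
Lemma same_third n (f g : cube R n -> T) :
  chart K f -> chart K g -> f (const_cube n (third R)) = g (const_cube n (third R)) ->
  exists2 q : 'I_n -> 'I_n, injective q & f = g \o sel q.
Proof.
move=> Kf Kg fg; have i3 := @interior_third R n.
have [p [b [pi -> pb]]] := same_cell_map Kf Kg i3 i3 fg.
have [q qi ->] := signed_perm_third pi pb.
by exists q.
Qed.

End DisjointCells.

(** * Links of vertices as finite set systems *)

Section SimplicialLinks.
Variables (R : realType) (T : choiceType) (K : cubing R T).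
Hypothesis simp : forall k (f : cube R k -> T), chart K f -> link_simplicial K f.
Hypothesis finK : finite_set (@chart R T K 1).

Lemma edge_inj m (F : cube R m -> T) : chart K F -> injective (edge F).
Proof.
move=> KF; have [inj _] := simp (vertex_chart_origin KF).
have := inj m F (proj2 (link_simplex_origin K F (origin F)) (conj KF erefl)).
by move=> i a b ab; apply: i; rewrite !link_vertex_edge.
Qed.

Lemma edge_ext m (F F' : cube R m -> T) : chart K F -> chart K F' ->
  origin F = origin F' -> edge F =1 edge F' -> F = F'.
Proof.
move=> KF KF' FF' E; have [_ ext] := simp (vertex_chart_origin KF).
apply: (ext m F F').
- exact/link_simplex_origin.
- exact/link_simplex_origin.
by apply/funext => i; rewrite !link_vertex_edge.
Qed.

Local Notation U := (fset_set (@chart R T K 1) : finType).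

(* Simplices of the link of a vertex are encoded by finite sets of oriented
   edges issued from it. *)
Definition vset m (F : cube R m -> T) : {set U} :=
  [set u : U | `[< exists i, val u = edge F i >]].

Lemma edge_in m (F : cube R m -> T) i :
  chart K F -> edge F i \in fset_set (@chart R T K 1).
Proof. by move=> KF; rewrite in_fset_set // inE; exact: chart_edge. Qed.

Definition uedge m (F : cube R m -> T) (KF : chart K F) i : U :=
  FSetSub (edge_in i KF).

Lemma mem_vset m (F : cube R m -> T) (KF : chart K F) i : uedge KF i \in vset F.
Proof. by rewrite inE; apply/asboolP; exists i. Qed.

Lemma vsetE m (F : cube R m -> T) (KF : chart K F) : vset F = uedge KF @: 'I_m.
Proof.
apply/setP => u; rewrite inE; apply/asboolP/imsetP => [[i ui]|[i _ ->]].
  by exists i => //; apply: val_inj.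
by exists i.
Qed.

Lemma card_vset m (F : cube R m -> T) : chart K F -> #|vset F| = m.
Proof.
move=> KF; rewrite (vsetE KF) card_imset ?card_ord //.
by move=> i j /(congr1 val) /(edge_inj KF).
Qed.

Lemma vset_sel m n (F : cube R n -> T) (q : 'I_m -> 'I_n) :
  chart K F -> injective q -> vset (F \o sel q) \subset vset F.
Proof.
move=> KF qi; apply/fintype.subsetP => u; rewrite !inE => -[i ui]; exists (q i).
by rewrite ui edge_sel.
Qed.

Lemma vset_perm n (F : cube R n -> T) (q : 'I_n -> 'I_n) :
  chart K F -> injective q -> vset (F \o sel q) = vset F.
Proof.
move=> KF qi; apply/eqP; rewrite eqEcard vset_sel //=.
by rewrite (card_vset KF) (card_vset (chart_sel qi KF)).
Qed.

(** Matching equal edges defines [q], which is injective because the edges of a cube at its origin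
    are distinct; a cube is then determined by its origin and these edges. *)
Lemma sub_cube m n (F : cube R m -> T) (F' : cube R n -> T) :
  chart K F -> chart K F' -> origin F = origin F' -> vset F \subset vset F' ->
  exists2 q : 'I_m -> 'I_n, injective q & F = F' \o sel q.
Proof.
move=> KF KF' FF' /fintype.subsetP sFF'.
have /choice[q qP] i : exists j, edge F i = edge F' j.
  by have := sFF' _ (mem_vset KF i); rewrite inE => /asboolP.
have qi : injective q.
  by move=> i j qij; apply: (edge_inj KF); rewrite !qP qij.
exists q => //; apply: edge_ext => //; first exact: chart_sel.
  by rewrite origin_sel.
by move=> i; rewrite edge_sel // qP.
Qed.

(** The link in the form required by the results on flag complexes; a vertex, as a cube of dimension
    0, provides the empty simplex. *)
Definition Lk (v : T) : {set {set U}} := [set s | `[< exists m (F : cube R m -> T),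
  [/\ chart K F, origin F = v & s = vset F] >]].

Lemma LkP v (s : {set U}) : reflect (exists m (F : cube R m -> T),
  [/\ chart K F, origin F = v & s = vset F]) (s \in Lk v).
Proof. by rewrite inE; exact: asboolP. Qed.

Lemma Lk_sub v (s t : {set U}) : t \in Lk v -> s \subset t -> s \in Lk v.
Proof.
move=> /LkP[m [F [KF F0 ->]]] /fintype.subsetP st.
have /choice[q qP] (i : 'I_#|s|) : exists j, val (enum_val i) = edge F j.
  by have := st _ (enum_valP i); rewrite inE => /asboolP.
have qi : injective q.
  move=> i j qij; apply: enum_val_inj; apply: val_inj; move: (qP i) (qP j).
  by rewrite qij => -> <-.
apply/LkP; exists #|s|, (F \o sel q); split; first exact: chart_sel.
  by rewrite origin_sel.
apply/setP => u; rewrite inE; apply/idP/asboolP => [us|[i ui]].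
  by exists (enum_rank_in us u); rewrite edge_sel // -qP enum_rankK_in.
have -> : u = enum_val i by apply: val_inj; rewrite ui edge_sel // qP.
exact: enum_valP.
Qed.

Lemma range_edge m (F : cube R m -> T) :
  chart K F -> range (edge F) = [set val u | u in [set u : U | u \in vset F]].
Proof.
move=> KF; apply/seteqP; split=> [_ [i _ <-]|x [u /=]].
  by exists (uedge KF i) => //=; exact: mem_vset.
by rewrite inE => /asboolP[i ui] <-; exists i.
Qed.

Lemma link_Lk v (s : {set U}) :
  link K (@vertex_chart R T v) [set val u | u in [set u : U | u \in s]] <-> s \in Lk v.
Proof.
rewrite link_vertexP; split=> [[m [F [KF F0 sE]]]|/LkP[m [F [KF F0 ->]]]].
  apply/LkP; exists m, F; split=> //; apply/setP => u.
  have E := congr1 (fun P : set (cube R 1 -> T) => P (val u)) sE.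
  rewrite range_edge //= in E.
  apply/idP/idP => us.
    have : [set val w | w in [set w : U | w \in s]] (val u) by exists u.
    by rewrite /= E => -[w /= wF /val_inj <-].
  have : [set val w | w in [set w : U | w \in vset F]] (val u) by exists u.
  by rewrite /= -E => -[w /= ws /val_inj <-].
by exists m, F; split=> //; rewrite range_edge.
Qed.

Lemma Lk_flag v (s : {set U}) : flag (link K (@vertex_chart R T v)) ->
  (forall u w, u \in s -> w \in s -> [set u; w]%SET \in Lk v) -> s \in Lk v.
Proof.
move=> fl s2; apply/link_Lk; apply: fl; first exact/finite_image/finite_finset.
move=> _ _ [u us <-] [w ws <-].
have -> : [set val u; val w] = [set val x | x in [set x : U | x \in [set u; w]%SET]].
  apply/seteqP; split=> [x [->|->]|_ [x /= + <-]].
  - by exists u; rewrite //= !inE eqxx.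
  - by exists w; rewrite //= !inE eqxx orbT.
  - by rewrite !inE => /orP[] /eqP ->; [left|right].
exact/link_Lk/s2.
Qed.

End SimplicialLinks.

(** * Links of cells and their Euler characteristics *)

Section FaceMapFactor.
Variable R : realType.

Lemma flip_unit0 : flip (unit0 R) = unit1 R.
Proof. by apply: val_inj; rewrite /= subr0. Qed.

(** Reflecting the cube moves a given face to the origin; a coordinate fixed at 1 counts as a
    reflected 0. *)
Lemma face_map_factor m n (e : cube R m -> cube R n) : face_map e ->
  exists q b, injective q /\ e = signed_perm id b \o sel q.
Proof.
move=> [c cq eE]; have /choice[q qP] := cq; have qi : injective q.
  by move=> i j qij; have [[b]] := qP i; have [[b']] := qP j; rewrite qij => -> _ [].
exists q, (fun i => match c i with Fixed b => b | Coord _ b => b end); split=> //.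
apply/funext => t; rewrite eE; apply/rowP => i; rewrite [LHS]mxE [RHS]mxE.
case ci : (c i) => [b|j b] /=.
  rewrite sel_out ?flip_unit0 // => j; apply/eqP => qj.
  by have [[b']] := qP j; rewrite qj ci.
have [_ qu] := qP j; rewrite -(qu i); last by exists b.
by rewrite selE.
Qed.

End FaceMapFactor.

Lemma fsum_finset (X : finType) (V : nmodType) (B : {set X}) (f : X -> V) :
  \sum_(x \in [set x | x \in B]) f x = \sum_(x in B) f x.
Proof.
rewrite (@bigfs _ _ _ _ (index_enum X) (mem B)) ?index_enum_uniq //.
by move=> i _; rewrite mem_index_enum.
Qed.

Lemma sgn_dim (m : nat) : (-1 : int) ^ (m%:Z - 1) = - (-1) ^+ m.
Proof.
case: m => [|m]; first by [].
by rewrite intS addrAC subrr add0r exprS mulN1r opprK.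
Qed.

Section EulerianLinks.
Variables (R : realType) (T : choiceType) (K : cubing R T).
Hypothesis simp : forall k (f : cube R k -> T), chart K f -> link_simplicial K f.
Hypothesis finK : finite_set (@chart R T K 1).

Local Notation U := (fset_set (@chart R T K 1) : finType).

Lemma row_mx0_sel k m (t : cube R k) :
  row_mx t (const_mx (unit0 R)) = sel (lshift m) t.
Proof.
apply/rowP => j; rewrite -[j]fintype.splitK; case: (fintype.split j) => a /=.
  by rewrite row_mxEl selE //; exact: lshift_inj.
by rewrite row_mxEr mxE sel_out // => i; rewrite eq_lrshift.
Qed.

Section LinkOfCell.
Variables (k : nat) (f : cube R k -> T).
Hypothesis Kf : chart K f.

Lemma link_simplexP m (F : cube R (k + m) -> T) :
  link_simplex K f F <-> chart K F /\ F \o sel (lshift m) = f.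
Proof.
split=> -[KF Ff]; split=> //; first by apply/funext => t; rewrite -Ff row_mx0_sel.
by move=> t; rewrite row_mx0_sel -Ff.
Qed.

Definition last_edge (u : cube R (k + 1) -> T) := edge u (rshift k ord0).

(** The simplex of the link of [f] that corresponds to a coface with edge set [t] at the origin: its
    vertices are the [(k+1)]-cells on [f] whose edge leaving [f] belongs to [t]. *)
Definition link_of_set (t : {set U}) : set (cube R (k + 1) -> T) :=
  [set u | [/\ chart K u, u \o sel (lshift 1) = f &
     exists2 w : U, w \in t :\: vset K f & val w = last_edge u]].

Lemma last_edge_link_vertex m (F : cube R (k + m) -> T) i :
  last_edge (link_vertex F i) = edge F (rshift k i).
Proof.
by rewrite link_vertex_sel /last_edge edge_sel ?link_index_r //; exact: link_index_inj.
Qed.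

Lemma link_vertex_face m (F : cube R (k + m) -> T) i :
  link_vertex F i \o sel (lshift 1) = F \o sel (lshift m).
Proof.
rewrite link_vertex_sel comp_sel; [|exact: lshift_inj|exact: link_index_inj].
by congr (F \o sel _); apply/funext => a /=; exact: link_index_l.
Qed.

Lemma chart_link_vertex m (F : cube R (k + m) -> T) i :
  chart K F -> chart K (link_vertex F i).
Proof. by rewrite link_vertex_sel; apply: chart_sel; exact: link_index_inj. Qed.

Lemma link_cell_ext (u u' : cube R (k + 1) -> T) : chart K u -> chart K u' ->
  u \o sel (lshift 1) = u' \o sel (lshift 1) -> last_edge u = last_edge u' ->
  u = u'.
Proof.
move=> Ku Ku' uu' ll; have li := @lshift_inj k 1.
apply: (edge_ext simp) => //; first by rewrite -(origin_sel u (lshift 1)) uu' origin_sel.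
move=> i; rewrite -[i]fintype.splitK; case: (fintype.split i) => a /=.
  by rewrite -!edge_sel // uu'.
by rewrite [a]ord1.
Qed.

Lemma range_link_vertex m (F : cube R (k + m) -> T) : link_simplex K f F ->
  range (link_vertex F) = link_of_set (vset K F).
Proof.
move=> /link_simplexP[KF Ff]; apply/seteqP; split=> [_ [i _ <-]|u].
  split; [exact: chart_link_vertex|by rewrite link_vertex_face|].
  exists (uedge finK KF (rshift k i)); last by rewrite last_edge_link_vertex.
  rewrite finset.in_setD mem_vset andbT; apply/negP; rewrite inE => /asboolP[j /=].
  rewrite -Ff edge_sel; last exact: lshift_inj.
  by move=> /(edge_inj simp KF)/eqP; rewrite eq_rlshift.
move=> [Ku uf [w]]; rewrite finset.in_setD => /andP[wf].
rewrite inE => /asboolP[j wj] wu.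
move: wj; rewrite -[j]fintype.splitK; case: (fintype.split j) => a /= wj.
  case/negP: wf; rewrite inE; apply/asboolP; exists a.
  by apply: etrans wj _; rewrite -Ff edge_sel //; exact: lshift_inj.
exists a => //; apply: link_cell_ext => //; first exact: chart_link_vertex.
  by rewrite link_vertex_face uf.
by rewrite last_edge_link_vertex; apply: etrans (esym wj) wu.
Qed.

Lemma card_range_link_vertex m (F : cube R (k + m) -> T) : link_simplex K f F ->
  #|` fset_set (range (link_vertex F))| = m.
Proof.
move=> Ff; have [inj _] := simp Kf.
rewrite fset_set_image; last exact: finite_finset.
rewrite card_imfset /=; last exact: inj Ff.
rewrite -[RHS](size_enum_ord m); apply: perm_size; apply: uniq_perm.
- exact: fset_uniq.
- exact: enum_uniq.
move=> i; rewrite in_fset_set; last exact: finite_finset.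
by rewrite mem_enum; apply: mem_set.
Qed.

(** Recovers the edges of a coface from its simplex in the link, which makes [link_of_set] injective
    on cofaces. *)
Lemma edges_of_link m (F : cube R (k + m) -> T) : link_simplex K f F ->
  vset K F = vset K f :|:
    [set w : U | `[< exists2 u, range (link_vertex F) u & val w = last_edge u >]].
Proof.
move=> /link_simplexP[KF Ff]; apply/setP => w; rewrite !inE.
apply/asboolP/orP => [[j]|[/asboolP[a wa]|/asboolP[_ [i _ <-] wi]]].
- rewrite -[j]fintype.splitK; case: (fintype.split j) => a /= wa; [left|right].
    apply/asboolP; exists a; apply: etrans wa _.
    by rewrite -Ff edge_sel //; exact: lshift_inj.
  apply/asboolP; exists (link_vertex F a); first by exists a.
  by rewrite last_edge_link_vertex.
- exists (lshift m a); apply: etrans wa _.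
  by rewrite -Ff edge_sel //; exact: lshift_inj.
- by exists (rshift k i); apply: etrans wi _; rewrite last_edge_link_vertex.
Qed.

Lemma vset_face m (F : cube R (k + m) -> T) : link_simplex K f F ->
  vset K f \subset vset K F.
Proof. by move=> /link_simplexP[KF <-]; apply: vset_sel => //; exact: lshift_inj. Qed.

Lemma origin_face m (F : cube R (k + m) -> T) : link_simplex K f F ->
  origin F = origin f.
Proof. by move=> /link_simplexP[KF <-]; rewrite origin_sel. Qed.

(** Reorders the coordinates of a coface so that the given face occupies the first [k], as
    [link_simplex] prescribes; the remaining ones enumerate the complement of the image of [q]. *)
Lemma extend_injection p (q : 'I_k -> 'I_p) : injective q ->
  exists m (q' : 'I_(k + m) -> 'I_p),
    [/\ (k + m)%N = p, injective q' & q' \o lshift m = q].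
Proof.
move=> qi; pose C : {set 'I_p} := ~: (q @: 'I_k)%SET.
have cC : (k + #|C|)%N = p.
  by rewrite /C -[X in (X + _)%N]card_ord -(card_imset _ qi) cardsC card_ord.
exists #|C|, (fun j => match fintype.split j with
   inl a => q a | inr b => enum_val b end); split=> //.
  move=> a b; rewrite -[a]fintype.splitK -[b]fintype.splitK !unsplitK.
  case: (fintype.split a) (fintype.split b) => a' [] b' /=.
  - by move=> /qi ->.
  - move=> ab; have := enum_valP b'; rewrite -ab /C finset.in_setC => /negP[].
    exact: imset_f.
  - move=> ab; have := enum_valP a'; rewrite ab /C finset.in_setC => /negP[].
    exact: imset_f.
  - by move=> /enum_val_inj ->.
apply/funext => a /=; rewrite -[lshift _ a]/(unsplit (inl a)) unsplitK //.
Qed.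

Lemma Lk_cofaces (t : {set U}) : t \in Lk K (origin f) -> vset K f \subset t ->
  exists m (F : cube R (k + m) -> T), link_simplex K f F /\ t = vset K F.
Proof.
move=> /LkP[p [F [KF F0 ->]]] ft.
have [q qi fE] := sub_cube simp finK Kf KF (esym F0) ft.
have [m [q' [kmp qi' q'q]]] := extend_injection qi.
move: q' qi' q'q; move: (kmp) => /esym kmpE; subst p => q' qi' q'q.
exists m, (F \o sel q'); split; last by rewrite vset_perm.
apply/link_simplexP; split; first exact: chart_sel.
by rewrite comp_sel ?q'q ?fE //; exact: lshift_inj.
Qed.

Local Notation cofaces :=
  [set t in Lk K (origin f) | vset K f \subset t]%SET.

Lemma link_cofaces : link K f = link_of_set @` [set t | t \in cofaces].
Proof.
apply/seteqP; split=> [_ [m [F [Ff ->]]]|_ [t /= + <-]].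
  exists (vset K F); last by rewrite range_link_vertex.
  rewrite /= inE vset_face // andbT; apply/LkP; exists _, F; split=> //.
    by have [] := Ff.
  exact: origin_face.
rewrite inE => /andP[tL ft]; have [m [F [Ff ->]]] := Lk_cofaces tL ft.
by exists m, F; split=> //; rewrite range_link_vertex.
Qed.

Lemma link_of_set_inj : set_inj [set t | t \in cofaces] link_of_set.
Proof.
move=> t t' /set_mem /= + /set_mem /=.
rewrite finset.in_set => /andP[tL ft]; rewrite finset.in_set => /andP[tL' ft'].
have [m [F [Ff ->]]] := Lk_cofaces tL ft.
have [m' [F' [Ff' ->]]] := Lk_cofaces tL' ft'.
rewrite -!range_link_vertex // => E.
by rewrite !edges_of_link // E.
Qed.

Lemma simplex_dim_link (t : {set U}) : t \in cofaces ->
  simplex_dim (link_of_set t) = #|t|%:Z - k%:Z - 1.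
Proof.
rewrite inE => /andP[tL ft]; have [m [F [Ff ->]]] := Lk_cofaces tL ft.
rewrite -range_link_vertex // /simplex_dim card_range_link_vertex //.
have [KF _] := Ff; rewrite (card_vset simp finK KF).
by rewrite PoszD [(k%:Z + _)%R]addrC addrK.
Qed.

End LinkOfCell.
End EulerianLinks.

Section EulerianComplex.
Variables (R : realType) (T : choiceType) (K : cubing R T) (n : nat).
Hypothesis eul : eulerian K n.
Hypothesis finK : finite_set (@chart R T K 1).

Local Notation U := (fset_set (@chart R T K 1) : finType).

Let simp k (f : cube R k -> T) : chart K f -> link_simplicial K f.
Proof. by move=> Kf; case: eul => s _ _; exact: s. Qed.

Local Notation cofaces f :=
  [set t in Lk K (origin f) | vset K f \subset t]%SET.

(** If [F] is a face of a cube, a reflection of that cube puts [F] at its origin and makes it a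
    coface of [f], of dimension at most [k + m] by hypothesis. So [F] is a maximal cell, and purity
    applies. *)
Lemma maximal_link_simplex k (f : cube R k -> T) m (F : cube R (k + m) -> T) :
  chart K f -> link_simplex K f F ->
  (forall m' (F' : cube R (k + m') -> T), link_simplex K f F' -> (m' <= m)%N) ->
  (k + m)%N = n.
Proof.
move=> Kf Ff maxF; have [_ pure _] := eul; apply: (pure _ F).
have [KF _] := Ff; split=> // p F' e KF' fe FE.
apply/eqP; rewrite eqn_leq (face_map_leq fe) andbT.
have [q [b [qi eE]]] := face_map_factor fe.
have KFb : chart K (F' \o signed_perm id b).
  by apply: chart_face KF'; exact: signed_perm_face.
have FE' : F = (F' \o signed_perm id b) \o sel q by rewrite FE eE.
have [||m' [F'' [Ff'' vE]]] :=
    @Lk_cofaces _ _ _ simp finK _ _ Kf (vset K (F' \o signed_perm id b)).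
- apply/LkP; exists p, (F' \o signed_perm id b); split=> //.
  by rewrite -(origin_face Ff) FE' origin_sel.
- by apply: (fintype.subset_trans (vset_face Ff)); rewrite FE'; exact: vset_sel.
have := maxF _ _ Ff''; rewrite -(leq_add2l k); apply: leq_trans.
have [KF'' _] := Ff''.
by rewrite -(card_vset simp finK KF'') -vE (card_vset simp finK KFb).
Qed.

(* The simplices of the link of the cell f are in bijection with the simplices of
   the link of its origin that contain [vset K f]; the dimension of the link is
   determined by purity. *)
Lemma sum_cofaces_int k (f : cube R k -> T) : chart K f ->
  \sum_(t in cofaces f) (-1) ^+ #|t| = (-1) ^+ n :> int.
Proof.
move=> Kf; have [_ _ /(_ k f Kf)[d [[s0 Ls0 s0d] maxd] chi]] := eul.
have fcof t : t \in cofaces f ->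
    exists m (F : cube R (k + m) -> T), link_simplex K f F /\ t = vset K F.
  by rewrite finset.in_set => /andP[tL ft]; exact: (Lk_cofaces simp finK Kf).
have dimt t m (F : cube R (k + m) -> T) : link_simplex K f F -> t = vset K F ->
    t \in cofaces f -> simplex_dim (link_of_set f t) = m%:Z - 1.
  move=> [KF _] tE tc; rewrite (simplex_dim_link simp finK Kf tc) tE.
  by rewrite (card_vset simp finK KF) PoszD [(k%:Z + _)%R]addrC addrK.
have Fcof m (F : cube R (k + m) -> T) : link_simplex K f F -> vset K F \in cofaces f.
  move=> Ff; rewrite finset.in_set (vset_face Ff) andbT; apply/LkP.
  by exists _, F; split; [case: Ff|exact: origin_face Ff|].
have linkE := link_cofaces simp finK Kf.
move: Ls0; rewrite linkE => -[t0 t0c s0E].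
have [m0 [F0 [Ff0 t0E]]] := fcof _ t0c.
have d0 : d = m0%:Z - 1 by rewrite -s0d -s0E (dimt t0 m0 F0).
(* [F0] comes from a simplex realising the dimension of the link, so no coface of [f] is larger. *)
have kn : (k + m0)%N = n.
  apply: (maximal_link_simplex Kf Ff0) => m' F' Ff'.
  have := maxd (link_of_set f (vset K F')).
  rewrite linkE (dimt _ _ _ Ff' erefl (Fcof _ _ Ff')) d0 => /(_ _).
  by rewrite lerD2r lez_nat; apply; exists (vset K F') => //; exact: Fcof.
have fink : finite_set (link K f).
  by rewrite linkE; apply: finite_image; exact: finite_finset.
have L0 : link K f set0.
  rewrite linkE; exists (vset K f).
    rewrite /= finset.in_set fintype.subxx andbT; apply/LkP.
    by exists k, f; split.
  by apply/seteqP; split=> // u [_ _ [w]]; rewrite finset.setDv finset.in_set0.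
have dim0 : simplex_dim (set0 : set (cube R (k + 1) -> T)) = -1.
  by rewrite /simplex_dim fset_set0 cardfs0.
have := chi; rewrite /euler_char => chi'.
(* The empty simplex, of dimension [-1], contributes [-1] and removes the 1 of the Euler
   characteristic. *)
have : \sum_(s \in link K f) (-1 : int) ^ simplex_dim s = (-1) ^ d.
  by rewrite (fsbigD1 set0) //= chi' dim0 addrA subrr add0r.
rewrite linkE fsbig_image; last exact: link_of_set_inj.
rewrite fsum_finset d0 sgn_dim => E.
rewrite -kn exprD; apply: oppr_inj; rewrite -mulrN -E mulr_sumr -sumrN.
apply: eq_bigr => t tc; have [m [F [Ff tE]]] := fcof _ tc.
rewrite (dimt t m F) // sgn_dim tE (card_vset simp finK); last by case: Ff.
by rewrite exprD mulrN.
Qed.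

End EulerianComplex.

(** * Diagonals of Eulerian complexes *)

Section EulerianDiagonals.
Variables (R : realType) (T : choiceType) (K : cubing R T) (n : nat).
Hypothesis hK : disjoint_cells K.
Hypothesis eul : eulerian K n.
Hypothesis flagK : forall v, vertices K v -> flag (link K (@vertex_chart R T v)).
Hypothesis finK : finite_set (@chart R T K 1).
Hypothesis finA : finite_set [set: ddiagonal K].

Local Notation U := (fset_set (@chart R T K 1) : finType).
Local Notation A := (ddiagonal K).
Local Notation rA := (enum_fset (fset_set [set: A])).

Let simp k (f : cube R k -> T) : chart K f -> link_simplicial K f.
Proof. by move=> Kf; case: eul => s _ _; exact: s. Qed.

Lemma Lk_vertex v (s : {set U}) : s \in Lk K v -> vertices K v.
Proof. by move=> /LkP[m [F [KF <- _]]]; exact: vertex_chart_origin KF. Qed.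

Lemma set0_Lk v : vertices K v -> finset.set0 \in Lk K v.
Proof.
move=> Kv; apply/LkP; exists 0%N, (@vertex_chart R T v); split=> //.
by apply/setP => u; rewrite finset.in_set0; apply/esym/negP; rewrite inE => /asboolP[[]].
Qed.

Lemma Lk_euler v (s : {set U}) : s \in Lk K v ->
  \sum_(t in Lk K v | s \subset t) ((-1) ^+ #|(t : {set U})| : rat) = (-1) ^+ n.
Proof.
move=> /LkP[m [F [KF <- ->]]].
have := congr1 (intr : int -> rat) (sum_cofaces_int eul finK KF).
rewrite rmorph_sum rmorphXn rmorphN1 => <-.
rewrite [RHS](eq_bigl (fun t => (t \in Lk K (origin F)) && (vset K F \subset t))).
  by apply: eq_bigr => t _; rewrite rmorphXn rmorphN1.
by move=> t; rewrite finset.in_set.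
Qed.

Lemma diagonal_ofE m (F : cube R m -> T) r : diagonal_of F r = F (const_cube m r).
Proof. by []. Qed.

Lemma same_diagonal_dim m m' (F : cube R m -> T) (F' : cube R m' -> T) :
  chart K F -> chart K F' -> diagonal_of F = diagonal_of F' -> m = m'.
Proof.
move=> KF KF' /(congr1 (@^~ (third R))); rewrite !diagonal_ofE.
by apply: (same_cell_dim hK) => //; exact: interior_third.
Qed.

Lemma same_diagonal m (F F' : cube R m -> T) :
  chart K F -> chart K F' -> diagonal_of F = diagonal_of F' ->
  exists2 q : 'I_m -> 'I_m, injective q & F = F' \o sel q.
Proof.
move=> KF KF' /(congr1 (@^~ (third R))); rewrite !diagonal_ofE.
exact: (same_third hK).
Qed.

Lemma diagonal_sel m (F : cube R m -> T) (q : 'I_m -> 'I_m) :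
  injective q -> diagonal_of (F \o sel q) = diagonal_of F.
Proof.
by move=> qi; apply/funext => r; rewrite !diagonal_ofE /= sel_const_sq.
Qed.

Lemma ddiagonalP (d : A) : exists m (F : cube R m.+1 -> T),
  [/\ chart K F, val d = diagonal_of F & origin F = dsource d].
Proof.
have := valP d; rewrite inE => -[m [F [KF dF]]]; exists m, F; split=> //.
by rewrite /dsource dF.
Qed.

Definition dset (d : A) : {set U} := [set u : U | `[< dsimplex d (val u) >]]%SET.

Lemma dsimplexE (d : A) m (F : cube R m -> T) : chart K F ->
  val d = diagonal_of F -> dsimplex d = range (edge F).
Proof.
move=> KF dF; apply/seteqP; split=> [u [m' [F' [KF' dF' [i ->]]]]|_ [i _ <-]].
  have mm' : m = m' := same_diagonal_dim KF KF' (etrans (esym dF) dF').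
  subst m'; rewrite link_vertex_edge.
  have [q qi ->] := same_diagonal KF' KF (etrans (esym dF') dF).
  by exists (q i) => //; rewrite edge_sel.
by exists m, F; split=> //; exists i; rewrite link_vertex_edge.
Qed.

Lemma dsetE (d : A) m (F : cube R m -> T) : chart K F ->
  val d = diagonal_of F -> dset d = vset K F.
Proof.
move=> KF dF; apply/setP => u; rewrite !finset.in_set (dsimplexE KF dF).
by apply/asboolP/asboolP => -[i]; [move=> _ <-; exists i|move=> ->; exists i].
Qed.

Lemma dset_Lk (d : A) : dset d \in Lk K (dsource d).
Proof.
have [m [F [KF dF F0]]] := ddiagonalP d.
by apply/LkP; exists m.+1, F; rewrite (dsetE KF dF).
Qed.

Lemma dset_neq0 (d : A) : dset d != finset.set0.
Proof.
have [m [F [KF dF F0]]] := ddiagonalP d.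
by rewrite -card_gt0 (dsetE KF dF) (card_vset simp finK KF).
Qed.

(** Together with [dset_surj], this puts the nontrivial diagonals issued from a vertex in bijection
    with the nonempty simplices of its link. *)
Lemma dset_inj (d d' : A) : dsource d = dsource d' -> dset d = dset d' -> d = d'.
Proof.
have [m [F [KF dF F0]]] := ddiagonalP d.
have [m' [F' [KF' dF' F0']]] := ddiagonalP d'.
rewrite (dsetE KF dF) (dsetE KF' dF') -F0 -F0' => OF VF.
have mm' : m = m'.
  by apply: succn_inj; rewrite -(card_vset simp finK KF) VF (card_vset simp finK KF').
subst m'; have [|q qi FE] := sub_cube simp finK KF KF' OF; first by rewrite VF.
by apply: val_inj; rewrite /= dF dF' FE diagonal_sel.
Qed.

Lemma dset_surj v (s : {set U}) : s \in Lk K v -> s != finset.set0 ->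
  exists2 d : A, dsource d = v & dset d = s.
Proof.
move=> /LkP[[|m] [F [KF F0 ->]]] s0.
  by move: s0; rewrite -card_gt0 (card_vset simp finK KF).
have dP : diagonal_of F \in nontrivial_diagonals K by rewrite inE; exists m, F.
exists (exist (fun d => d \in nontrivial_diagonals K) _ dP) => //.
by apply: dsetE.
Qed.

Lemma card_dset_star (d : A) : #|dset (dstar d)| = #|dset d|.
Proof.
have [m [F [KF dF F0]]] := ddiagonalP d.
pose r := signed_perm (R := R) (@id 'I_m.+1) (fun=> true).
have KF' : chart K (F \o r) by apply: chart_face KF; exact: signed_perm_face.
have dF' : val (dstar d) = diagonal_of (F \o r).
  rewrite /= dF; apply/funext => t; rewrite /= !diagonal_ofE /=; congr (F _).
  by apply/rowP => i; rewrite !mxE.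
by rewrite (dsetE KF dF) (dsetE KF' dF') !(card_vset simp finK).
Qed.

Lemma dstarK : involutive (@dstar R T K).
Proof.
move=> d; apply: val_inj; apply/funext => t /=.
by rewrite flipK.
Qed.

Lemma dsource_star (d : A) : dsource (dstar d) = dtarget d.
Proof. by rewrite /dsource /= flip_unit0. Qed.

Lemma dtarget_star (d : A) : dtarget (dstar d) = dsource d.
Proof. by rewrite -dsource_star dstarK. Qed.

Local Notation step i j := `[< normal_step i j >].

Lemma val_image_inj (s t : {set U}) :
  [set val u | u in [set u : U | u \in s]] `<=` [set val u | u in [set u : U | u \in t]] ->
  s \subset t.
Proof.
move=> st; apply/fintype.subsetP => u us.
by have [|w /= wt /val_inj <-] := st (val u); first by exists u.
Qed.

Lemma dsimplex_dset (d : A) :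
  dsimplex d = [set val u | u in [set u : U | u \in dset d]].
Proof.
have [m [F [KF dF F0]]] := ddiagonalP d.
by rewrite (dsimplexE KF dF) (dsetE KF dF) (range_edge finK KF).
Qed.

(** Reversing the first diagonal places both simplices in the link of one vertex, and the left side
    is [h a b]. A simplex containing [dset a] and [u] has the face [u |: dset a], so [star_verts]
    gives all the vertices of the star. *)
Lemma normal_stepE (a b : A) : step (dstar a) b =
  (dsource a == dsource b) && ~~ star_meets (Lk K (dsource a)) (dset a) (dset b).
Proof.
rewrite /normal_step dtarget_star dstarK.
apply/asboolP/andP => [[ab Sab]|[/eqP ab ab0]].
  split; first exact/eqP.
  apply/negP => /set0Pn[u]; rewrite finset.in_setI => /andP[ub].
  rewrite finset.in_set => uaL.
  suff : (set0 : set (cube R 1 -> T)) (val u) by [].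
  rewrite -Sab; split; last by rewrite dsimplex_dset; exists u.
  exists [set val w | w in [set w : U | w \in (u |: dset a)%SET]].
    split; first exact/(link_Lk finK).
    rewrite /= dsimplex_dset => _ [w /= wa <-]; exists w => //=.
    by rewrite finset.in_setU wa orbT.
  by exists u => //=; rewrite setU11.
split=> //; apply/seteqP; split=> // x [[r [Lr ar] rx] bx].
have [m [F [KF F0 rE]]] : exists m (F : cube R m -> T),
    [/\ chart K F, origin F = dsource a & r = range (edge F)].
  exact/link_vertexP.
case/negP: ab0; apply/set0Pn.
move: bx; rewrite dsimplex_dset => -[u /= ub ux]; exists u.
rewrite finset.in_setI ub finset.in_set /=.
have FL : vset K F \in Lk K (dsource a) by apply/LkP; exists m, F.
apply: (Lk_sub FL).
rewrite finset.subUset finset.sub1set; apply/andP; split.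
  move: rx; rewrite rE (range_edge finK KF) -ux => -[w /= wF /val_inj <-] //.
by apply: val_image_inj; rewrite -dsimplex_dset -(range_edge finK KF) -rE.
Qed.

Lemma sum_diagonals (V : nmodType) v (g : {set U} -> V) :
  \sum_(k <- rA | dsource k == v) g (dset k) =
  \sum_(t in Lk K v | t != finset.set0) g t.
Proof.
rewrite -big_filter -(big_map dset xpredT).
rewrite -[RHS]big_enum_cond /= -[RHS]big_filter; apply: perm_big; apply: uniq_perm.
- rewrite map_inj_in_uniq ?filter_uniq ?fset_uniq // => d d'.
  rewrite !mem_filter => /andP[/eqP dv _] /andP[/eqP d'v _].
  by apply: dset_inj; rewrite dv d'v.
- by rewrite filter_uniq ?enum_uniq.
move=> t; rewrite mem_filter mem_enum; apply/mapP/andP => [[d]|[t0 tL]].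
  rewrite mem_filter => /andP[/eqP <- _] ->.
  by split; [exact: dset_neq0|exact: dset_Lk].
have [d dv dt] := dset_surj tL t0; exists d => //.
by rewrite mem_filter dv eqxx /= in_fset_set ?inE.
Qed.

Local Notation sgn d := ((-1) ^+ #|dset d| : rat).


Let L_flag v (Kv : vertices K v) s := @Lk_flag _ _ _ finK v s (flagK Kv).

(** The star of the empty simplex is the whole link; this allows the trivial diagonal to be left out
    of the sums below. *)
Lemma star_meets_set0l v (t : {set U}) : t \in Lk K v -> t != finset.set0 ->
  star_meets (Lk K v) finset.set0 t.
Proof.
move=> tL t0; rewrite /star_meets.
suff -> : (t :&: star_verts (Lk K v) finset.set0 = t)%SET by [].
apply/finset.setIidPl/fintype.subsetP => u ut; rewrite finset.in_set finset.setU0.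
by apply: (Lk_sub tL); rewrite finset.sub1set.
Qed.

Lemma star_meets_set0r v (t : {set U}) : star_meets (Lk K v) t finset.set0 = false.
Proof. by rewrite /star_meets finset.set0I eqxx. Qed.

Lemma sum_diagonals_cond v (P : pred {set U}) :
  \sum_(k <- rA) (dsource k == v)%:R * sgn k * (P (dset k))%:R =
  \sum_(t in Lk K v | P t && (t != finset.set0)) (-1) ^+ #|t| :> rat.
Proof.
transitivity (\sum_(k <- rA | dsource k == v)
    (if P (dset k) then sgn k else 0)).
  rewrite [RHS]big_mkcond; apply: eq_bigr => k _.
  by case: eqP => _; case: (P _); rewrite ?mul0r ?mulr0 ?mul1r ?mulr1.
rewrite (sum_diagonals v (fun t => if P t then (-1) ^+ #|t| else 0 : rat)).
by rewrite -big_mkcondr; apply: eq_bigl => t; rewrite -andbA [P t && _]andbC.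
Qed.

(** Both sides vanish unless [dstar a] and [b] have the same source; there it is [sum_not_meets2],
    whose term at the empty simplex is zero because [dset b] is nonempty. *)
Lemma sum_normal_normal (a b : A) :
  \sum_(k <- rA) (step a k)%:R * sgn k * (step (dstar k) b)%:R
  = (dstar a == b)%:R * sgn a.
Proof.
rewrite -{1}(dstarK a) -card_dset_star; move: (dstar a) => {}a.
have [ab|ab] := eqVneq (dsource a) (dsource b); last first.
  rewrite big1 => [|k _].
    by case: (eqVneq a b) ab => [->|_ _]; rewrite ?eqxx // mul0r.
  rewrite !normal_stepE; case: eqP => [ak|_] /=; last by rewrite !mul0r.
  by case: eqP => [kb|_]; [rewrite ak kb eqxx in ab|rewrite mulr0].
pose v := dsource a; have Kv := Lk_vertex (dset_Lk a).
transitivity (\sum_(k <- rA) (dsource k == v)%:R * sgn k *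
    (~~ star_meets (Lk K v) (dset a) (dset k) &&
     ~~ star_meets (Lk K v) (dset k) (dset b))%:R).
  apply: eq_bigr => k _; rewrite !normal_stepE -/v [v == _]eq_sym -ab -/v.
  have [->|_] := eqVneq (dsource k) v; last by rewrite !mul0r.
  by rewrite /= -mulnb natrM mul1r mulrA; congr (_ * _); exact: mulrC.
rewrite (sum_diagonals_cond v (fun t => ~~ star_meets (Lk K v) (dset a) t &&
  ~~ star_meets (Lk K v) t (dset b))).
have bL : dset b \in Lk K v by rewrite /v ab; exact: dset_Lk.
have -> : (a == b) = (dset a == dset b).
  by apply/eqP/eqP => [->//|]; exact: dset_inj.
rewrite -(sum_not_meets2 (@Lk_sub _ _ _ v) (L_flag Kv) (@Lk_euler v) (dset_Lk a) bL).
apply: eq_bigl => t; have [->|t0] := eqVneq t finset.set0; last by rewrite andbT.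
by rewrite (star_meets_set0l bL (dset_neq0 b)) !andbF.
Qed.

Lemma sum_normal_source (a : A) v :
  \sum_(k <- rA) (step a k)%:R * sgn k * (dsource k == v)%:R
  = - (dtarget a == v)%:R.
Proof.
rewrite -{1}(dstarK a) -dsource_star; move: (dstar a) => {}a.
have [av|av] := eqVneq (dsource a) v; last first.
  rewrite big1 ?oppr0 // => k _; rewrite normal_stepE.
  case: eqP => [ak|_] /=; last by rewrite !mul0r.
  by rewrite -ak (negPf av) mulr0.
have Kv := Lk_vertex (dset_Lk a); rewrite av in Kv.
have aL : dset a \in Lk K v by rewrite -av; exact: dset_Lk.
transitivity (\sum_(k <- rA) (dsource k == v)%:R * sgn k *
    (~~ star_meets (Lk K v) (dset a) (dset k))%:R).
  apply: eq_bigr => k _; rewrite normal_stepE av [v == _]eq_sym.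
  have [_|_] := eqVneq (dsource k) v; last by rewrite mulr0 !mul0r.
  by rewrite mulr1 /= mul1r mulrC.
rewrite (sum_diagonals_cond v (fun t => ~~ star_meets (Lk K v) (dset a) t)).
(* At [t = set0] the full sum is 0, [dset a] being nonempty, and its term at the empty simplex is 1:
   the nonempty simplices add up to [-1]. *)
have := sum_not_meets2 (@Lk_sub _ _ _ v) (L_flag Kv) (@Lk_euler v) aL (set0_Lk Kv).
rewrite (negPf (dset_neq0 a)) mul0r (bigD1 finset.set0) /=; last first.
  by rewrite set0_Lk // !star_meets_set0r.
rewrite cards0 expr0 => /eqP; rewrite addrC addr_eq0 => /eqP E.
rewrite -[RHS]E; apply: eq_bigl => t.
by rewrite star_meets_set0r andbT andbA.
Qed.

Lemma sum_source_normal v (b : A) :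
  \sum_(k <- rA) (dsource k == v)%:R * sgn k * (step (dstar k) b)%:R
  = (-1) ^+ n * (dsource b == v)%:R.
Proof.
have [bv|bv] := eqVneq (dsource b) v; last first.
  rewrite big1 ?mulr0 // => k _; rewrite normal_stepE.
  case: (eqVneq (dsource k) (dsource b)) => [->|_] /=; last by rewrite mulr0.
  by rewrite (negPf bv) !mul0r.
have Kv := Lk_vertex (dset_Lk b); rewrite bv in Kv.
have bL : dset b \in Lk K v by rewrite -bv; exact: dset_Lk.
transitivity (\sum_(k <- rA) (dsource k == v)%:R * sgn k *
    (~~ star_meets (Lk K v) (dset k) (dset b))%:R).
  apply: eq_bigr => k _; rewrite normal_stepE bv.
  by have [->|_] := eqVneq (dsource k) v; rewrite // !mul0r.
rewrite (sum_diagonals_cond v (fun t => ~~ star_meets (Lk K v) t (dset b))).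
rewrite mulr1 -(sum_not_meets (@Lk_sub _ _ _ v) (L_flag Kv) (@Lk_euler v) bL).
apply: eq_bigl => t; have [->|t0] := eqVneq t finset.set0; last by rewrite andbT.
by rewrite (star_meets_set0l bL (dset_neq0 b)) !andbF.
Qed.

Lemma sum_source_source v v' : vertices K v ->
  \sum_(k <- rA) (dsource k == v)%:R * sgn k * (dsource k == v')%:R
  = (v == v')%:R * ((-1) ^+ n - 1).
Proof.
move=> Kv; have [<-|vv'] := eqVneq v v'; last first.
  rewrite big1 ?mul0r // => k _; case: eqP => [->|_]; last by rewrite !mul0r.
  by rewrite (negPf vv') mulr0.
transitivity (\sum_(k <- rA) (dsource k == v)%:R * sgn k * true%:R).
  by apply: eq_bigr => k _; case: eqP => _; rewrite ?mul0r.
rewrite (sum_diagonals_cond v xpredT) mul1r -(Lk_euler (set0_Lk Kv)).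
rewrite [in RHS](bigD1 finset.set0) ?set0_Lk ?finset.sub0set //= cards0 expr0.
rewrite addrC addrK; apply: eq_bigl => t.
by rewrite finset.sub0set andbT.
Qed.

End EulerianDiagonals.

(** * Orbit complexes *)

Section CubeTopology.
Variable R : realType.

Lemma unit_interval_accessible : accessible_space (unit_interval R).
Proof.
move=> x y xy; have vxy : val x != val y by rewrite (inj_eq val_inj).
have [B [oB xB yB]] := hausdorff_accessible (@Rhausdorff R) vxy.
exists (val @^-1` B); split; last 2 first.
- by apply: mem_set; have := set_mem xB.
- by apply: mem_set; have := set_mem yB.
have /continuousP := @initial_continuous (unit_interval R) R set_val.
exact.
Qed.

Lemma cube_accessible n : accessible_space (cube R n).
Proof.
move=> x y xy; have [i xyi] : exists i, x ord0 i != y ord0 i.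
  apply/existsP; apply: contra_neqT xy; rewrite negb_exists => /forallP xy.
  by apply/rowP => i; apply/eqP; have := xy i; rewrite negbK.
have [B [oB xB yB]] := unit_interval_accessible xyi.
exists [set t : cube R n | B (t ord0 i)]; split; last 2 first.
- by apply: mem_set; have := set_mem xB.
- by apply: mem_set; have := set_mem yB.
rewrite openE => t /= Bt.
exists (fun _ j => if j == i then B else setT).
  move=> k j; case: eqP => [->|_]; last exact: filterT.
  by rewrite [k]ord1; apply: open_nbhs_nbhs.
by move=> s /= /(_ ord0 i); rewrite eqxx.
Qed.

Lemma finite_cube_closed n (A : set (cube R n)) : finite_set A -> closed A.
Proof. by have /accessible_finite_set_closed := @cube_accessible n; apply. Qed.

End CubeTopology.

Section FiniteCells.
Variables (R : realType) (T : choiceType) (K : cubing R T).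
Hypothesis hK : disjoint_cells K.

(** All symmetries of the cube fix its midpoint, so a cell has a single center whatever its chart,
    and finiteness of cells can be read on points. *)
Definition centers : set T :=
  [set x | exists n (f : cube R n -> T), chart K f /\ x = f (const_cube n (midpoint R))].

(** The charts with a given center differ by one of finitely many signed permutations. The map [Psi]
    sends charts of all dimensions to one type, so that a single statement covers edges, diagonals
    and vertices. *)
Lemma finite_cells (Z : Type) (Psi : forall n, (cube R n -> T) -> Z) :
  finite_set centers ->
  finite_set [set z | exists n (f : cube R n -> T), chart K f /\ z = Psi n f].
Proof.
move=> finC; pose cells x := [set z | exists n (f : cube R n -> T),
  [/\ chart K f, f (const_cube n (midpoint R)) = x & z = Psi n f]].
apply: (@sub_finite_set _ _ (\bigcup_(x in centers) cells x)).
  move=> z [n [f [Kf zE]]]; exists (f (const_cube n (midpoint R))); first by exists n, f.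
  by exists n, f.
apply: bigcup_finite => // x [n [f [Kf xE]]].
apply: (@sub_finite_set _ _ ((fun pb : {ffun 'I_n -> 'I_n} * {ffun 'I_n -> bool} =>
    Psi n (f \o signed_perm pb.1 pb.2)) @` setT)); last first.
  by apply: finite_image; exact: finite_finset.
move=> z [m [g [Kg gx ->]]]; have ci := @interior_midpoint R.
have mn : m = n by apply: (same_cell_dim hK Kg Kf (ci _) (ci _)); rewrite gx.
subst m; have [|p [b [_ -> _]]] := same_cell_map hK Kg Kf (ci _) (ci _).
  by rewrite gx.
exists (finfun p, finfun b) => //=; congr (Psi n (f \o _)).
by apply/funext => t; apply/rowP => i; rewrite !mxE !ffunE.
Qed.

End FiniteCells.

Section CubeComplex.
Variables (R : realType) (X : topologicalType) (K : cubing R X).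
Hypothesis hK : cube_complex K.

Lemma cube_complex_disjoint : disjoint_cells K.
Proof. by case: hK => _ inj disj _; split. Qed.

(** Each coordinate of the center of a face is 0, 1/2 or 1. *)
Lemma finite_face_centers n : finite_set [set t : cube R n |
  exists m (e : cube R m -> cube R n), face_map e /\ t = e (const_cube m (midpoint R))].
Proof.
pose F (g : {ffun 'I_n -> option bool}) : cube R n := \row_i
  (match g i with None => midpoint R | Some b => if b then unit1 R else unit0 R end).
apply: (@sub_finite_set _ _ (F @` setT)).
  move=> t [m [e [[c _ eE] ->]]].
  exists [ffun i => match c i with Fixed b => Some b | Coord _ _ => None end] => //.
  rewrite eE; apply/rowP => i; rewrite !mxE ffunE.
  by case: (c i) => [//|j b] /=; rewrite mxE flip_midpoint if_same.
by apply: finite_image; exact: finite_finset.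
Qed.

(** The weak topology reduces the claim to each closed cube. A point of the cube mapped to a center
    lies in the interior of some face, parametrising the same cell, and is therefore the center of
    that face. *)
Lemma centers_closed (D : set X) : D `<=` centers K -> closed D.
Proof.
move=> DC; have hD := cube_complex_disjoint.
rewrite -openC; apply/(weak_topology hK) => n f Kf.
rewrite preimage_setC openC; apply: finite_cube_closed.
apply: sub_finite_set (finite_face_centers n) => t /DC [m [g [Kg fg]]].
have [k [e [s [fe si es]]]] := cube_interior_face t.
have Kfe := chart_face fe Kf; have ci := @interior_midpoint R m.
have fgs : g (const_cube m (midpoint R)) = (f \o e) s by rewrite -fg /= es.
have mk := same_cell_dim hD Kg Kfe ci si fgs.
subst k; exists m, e; split=> //.
have [p [b [_ _]]] := same_cell_map hD Kg Kfe ci si fgs.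
by rewrite signed_perm_midpoint -es => ->.
Qed.

End CubeComplex.

(** * From X to the orbit space *)

Section OrbitComplex.
Variables (R : realType) (G : groupType) (X : topologicalType).
Variables (K : cubing R X) (a : group_action G X).
Hypotheses (hC : cube_complex K) (freea : free_action a).
Hypothesis (cella : cellular_action a K).

Local Notation Y := (orbit_space a).
Local Notation pi := (@orbit_proj G X a).
Local Notation K' := (orbit_cubing a K).

Let hK := cube_complex_disjoint hC.

Lemma orbit_projP x y : pi x = pi y <-> exists g, a g x = y.
Proof.
rewrite /orbit_proj; split=> [/(@eqquotP _ (orbit_equiv a))/asboolP //|h].
by apply/(@eqquotP _ (orbit_equiv a))/asboolP.
Qed.

(* A group element mapping a cell to itself fixes its center, hence is trivial. *)
Lemma orbit_disjoint : disjoint_cells K'.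
Proof.
split=> [m _ s t [h Kh <-] si ti /= /orbit_projP[g ghs]|
         m m' _ _ s t [h Kh <-] [h' Kh' <-] si ti /= /orbit_projP[g ghs]].
  have [p [b [_ gh _]]] := same_cell_map hK (cella g Kh) Kh si ti ghs.
  have g1 : g = 1%g.
    apply: (freea (x := h (const_cube m (midpoint R)))).
    by rewrite -[LHS]/((a g \o h) _) gh /= signed_perm_midpoint.
  by move: ghs; rewrite g1 act_1; exact: cell_inj hK m h s t Kh si ti.
have [e fe hE] := cell_disjoint hK (cella g Kh) Kh' si ti ghs.
exists e => //; apply/funext => r /=; apply/orbit_projP; exists g.
by rewrite -[LHS]/((a g \o h) r) hE.
Qed.

(* Every set of centers of cells is closed, because a cube contains finitely many
   of them; hence a compact complex has finitely many cells. *)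
Lemma finite_centers : cocompact_action a -> finite_set (centers K').
Proof.
move=> coco.
have centersE x : centers K' (pi x) -> centers K x.
  move=> [m [_ [[h Kh <-] /esym /orbit_projP[g <-]]]].
  by exists m, (a g \o h); split=> //; exact: cella.
have clo (D : set Y) : D `<=` centers K' -> closed D.
  move=> DC; rewrite -openC; rewrite /open /= /quotient_open preimage_setC openC.
  apply: (centers_closed hC) => x /DC; exact: centersE.
have [C0|/set0P[c0 c0C]] := eqVneq (centers K') set0; first by rewrite C0.
pose Yp : ptopologicalType := HB.pack Y (isPointed.Build Y c0).
(* The open set attached to a center [c] omits all the other centers, so the centers belong to any
   finite set of indices of a subcover; [c0] takes care of the points that are not centers. *)
have : compact [set: Yp] by [].
rewrite compact_cover => /(_ _ (centers K'))/(_
    (fun c => ~` (centers K' `\` [set c]))) [|y _|D' D'C cov].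
- by move=> c _; rewrite openC; apply: clo => y [].
- have [yC|yC] := pselect (centers K' y); first by exists y => // -[_] /(_ erefl).
  by exists c0 => // -[].
apply: (@sub_finite_set _ _ [set` D']) => [y yC|]; last exact: finite_fset.
have [c cD' cy] := cov y I; suff -> : y = c by [].
by apply: contrapT => yc; apply: cy.
Qed.

(** Two lifts differ by a group element, with no permutation of coordinates possible in dimension 1;
    as they have the same origin, this element fixes a vertex and is trivial by freeness. *)
Lemma lift_edge_unique (h h' : cube R 1 -> X) : chart K h -> chart K h' ->
  pi \o h = pi \o h' -> origin h = origin h' -> h = h'.
Proof.
move=> Kh Kh' hh' oo.
have /orbit_projP[g gh] := congr1 (fun u => u (const_cube 1 (third R))) hh'.
have [q qi ghE] := same_third hK (cella g Kh) Kh' gh.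
have ghh' : a g \o h = h'.
  by rewrite ghE; apply/funext => t /=; rewrite sel_ord1.
have g1 : g = 1%g.
  by apply: (freea (x := origin h)); rewrite {2}oo -ghh'.
by rewrite -ghh' g1; apply/funext => t /=; rewrite act_1.
Qed.

Lemma edge_comp (Z : choiceType) m (H : cube R m -> X) (f : X -> Z) i :
  edge (f \o H) i = f \o edge H i.
Proof. by []. Qed.

Lemma lift_chart v m (F : cube R m -> Y) : chart K' F -> origin F = pi v ->
  exists H, [/\ chart K H, origin H = v & F = pi \o H].
Proof.
move=> [H KH <-]; rewrite /origin /= => /orbit_projP[g gv].
exists (a g \o H); split=> //; first exact: cella.
by apply/funext => t /=; apply/esym/orbit_projP; exists g^-1%g; rewrite -act_M mulVg act_1.
Qed.

(** All the edges in [s] are lifted to one vertex [u] above [v]. A simplex spanned by two of them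
    lifts at [u] as well, and by uniqueness its edges are the chosen lifts; flagness at [u] then
    yields a cube, which is projected. *)
Lemma orbit_flag v : (forall u, vertices K u -> flag (link K (@vertex_chart R X u))) ->
  vertices K' v -> flag (link K' (@vertex_chart R Y v)).
Proof.
move=> flK [h0 Kh0 hv]; pose u := h0 (const_cube 0 (unit0 R)).
have uv : pi u = v by have := congr1 (@^~ (const_cube 0 (unit0 R))) hv.
have Ku : vertices K u.
  by rewrite /vertices /=; have := @vertex_chart_origin _ _ _ _ h0 Kh0.
move=> s fs s2.
have /choice[lift liftP] (e : cube R 1 -> Y) : exists h : cube R 1 -> X,
    s e -> [/\ chart K h, origin h = u & e = pi \o h].
  (* Outside [s] the lift is an arbitrary default. Inside, the pair made of [e] twice shows that [e]
     is a vertex of the link. *)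
  have [se|nse] := pselect (s e); last by exists (fun=> u).
  have /link_vertexP[m [F [KF F0 FE]]] := s2 e e se se.
  have [H [KH H0 HE]] := lift_chart KF (etrans F0 (esym uv)).
  have [i _ iE] : range (edge F) e by rewrite -FE; left.
  exists (edge H i) => _; split; [exact: chart_edge|by rewrite /edge origin_sel|].
  by rewrite -iE HE.
have [] : link K (@vertex_chart R X u) (lift @` s).
  apply: flK => //; first exact: finite_image.
  move=> _ _ [e se <-] [e' se' <-].
  have /link_vertexP[m [F [KF F0 FE]]] := s2 e e' se se'.
  have [H [KH H0 HE]] := lift_chart KF (etrans F0 (esym uv)).
  have [Ke oe eE] := liftP e se; have [Ke' oe' e'E] := liftP e' se'.
  have Hedge i : origin (edge H i) = u by rewrite /edge origin_sel.
  apply/link_vertexP; exists m, H; split=> //.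
  apply/seteqP; split=> [f [->|->]|f [i _ <-]].
  - have [i _ iE] : range (edge F) e by rewrite -FE; left.
    exists i => //; apply: lift_edge_unique => //; first exact: chart_edge.
      by rewrite -eE -iE HE.
    by rewrite Hedge oe.
  - have [i _ iE] : range (edge F) e' by rewrite -FE; right.
    exists i => //; apply: lift_edge_unique => //; first exact: chart_edge.
      by rewrite -e'E -iE HE.
    by rewrite Hedge oe'.
  have : [set e; e'] (edge F i) by rewrite FE; exists i.
  move=> [fe|fe]; [left|right]; apply: lift_edge_unique => //; try exact: chart_edge.
  - by rewrite -eE -fe HE.
  - by rewrite Hedge oe.
  - by rewrite -e'E -fe HE.
  - by rewrite Hedge oe'.
move=> m [H [/link_simplex_origin[KH H0] HE]].
apply/link_vertexP; exists m, (pi \o H); split.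
- by exists H.
- by rewrite -uv -H0.
have HE' : lift @` s = range (edge H).
  by rewrite HE; congr image; apply/funext => i; exact: link_vertex_edge.
apply/seteqP; split=> [e se|_ [i _ <-]].
  have [i _ iE] : range (edge H) (lift e) by rewrite -HE'; exists e.
  by exists i => //; rewrite edge_comp iE; have [_ _ <-] := liftP e se.
have [e se eE] : (lift @` s) (edge H i) by rewrite HE'; exists i.
by rewrite edge_comp -eE; have [_ _ <-] := liftP e se.
Qed.

End OrbitComplex.

Lemma finite_set_type (T : Type) (P B : set T) :
  finite_set B -> P `<=` B -> finite_set [set: set_type P].
Proof.
move=> fB PB.
have valI : {in [set: set_type P] &, injective val} by move=> d d' _ _; exact: val_inj.
rewrite -(eq_finite_set (inj_card_eq valI)); apply: sub_finite_set fB.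
by move=> _ [d _ <-]; apply: PB; have := valP d; rewrite inE.
Qed.

Section StarSeries.
Variable A : choiceType.
Implicit Types (L : set (seq A)) (w : freegroup A).

Lemma char_series_word L u : char_series L (fg_of_word u) = (`[< L u >])%:R.
Proof.
rewrite /char_series; have [Lu|nLu] := asboolP (L u).
  rewrite (fsum_seq (r := [:: u])) ?big_seq1 //.
  - by move=> i; rewrite inE => /eqP ->.
  by move=> i [_ /(can_inj (@lettersK A)) ->]; rewrite inE eqxx.
by rewrite fsbig1 // => u' [Lu' /(can_inj (@lettersK A)) uu]; rewrite -uu in nLu.
Qed.

(** Positive words determine their letters and [f] is involutive, so at most one word contributes to
    each coefficient. *)
Lemma smap_char_series L (f : A -> A) w : involutive f ->
  smap f (char_series L) w =
  (positive w && `[< L (map f (letters w)) >])%:R.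
Proof.
move=> fK; rewrite /smap; have [pw|nw] /= := boolP (positive w); last first.
  rewrite fsbig1 // => u /= uw; case/negP: nw.
  by rewrite -uw positive_of_word.
rewrite (fsum_seq (r := [:: map f (letters w)])) //.
- by rewrite big_seq1 char_series_word.
- by move=> u; rewrite inE => /eqP -> /=; rewrite (mapK fK) of_wordK.
move=> u /= <-; rewrite lettersK (mapK fK) inE eqxx //.
Qed.

End StarSeries.

Theorem theorem5p0p1 (R : realType) (G : groupType) (X : topologicalType)
    (K : cubing R X) (a : group_action G X) (n : nat) :
  cube_complex K -> CAT0 K ->
  free_action a -> cellular_action a K -> cocompact_action a ->
  eulerian (orbit_cubing a K) n ->
  forall x y : vertex (orbit_cubing a K),
    reciprocal_exists (orbit_cubing a K) /\
    reciprocal x y = sscale ((-1) ^+ n) (path_series_star x y).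
Proof.
move=> hC [_ cat0] freea cella coco; set K' := orbit_cubing a K => eul x y.
have hK : disjoint_cells K' by exact: orbit_disjoint.
have flK v : vertices K' v -> flag (link K' (@vertex_chart R _ v)).
  by apply: orbit_flag => // u Ku; have [] := cat0 u Ku.
have finC := finite_centers hC cella coco.
have finK : finite_set (@chart R _ K' 1).
  (* [Psi] sends a chart of any dimension to its diagonal seen as a map on the 1-cube; on a chart of
     dimension 1 it is the identity. *)
  apply: sub_finite_set (finite_cells hK
    (fun m (f : cube R m -> orbit_space a) =>
       (fun t : cube R 1 => f (\row_i t ord0 ord0))) finC) => f Kf.
  exists 1%N, f; split=> //; apply/funext => t; congr (f _).
  by apply/rowP => i; rewrite mxE [i]ord1.
have finA : finite_set [set: ddiagonal K'].
  apply: finite_set_type (finite_cells hK (fun m f => diagonal_of f) finC) _.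
  by move=> _ [m [f [Kf ->]]]; exists m.+1, f.
have finV : finite_set [set: vertex K'].
  apply: finite_set_type (finite_cells hK (fun m f => origin f) finC) _.
  by move=> v Kv; exists 0%N, (@vertex_chart R _ v).
pose step (i j : ddiagonal K') := `[< normal_step i j >].
pose src (i : ddiagonal K') (v : vertex K') := `[< dsource i = val v >].
pose tgt (i : ddiagonal K') (v : vertex K') := `[< dtarget i = val v >].
have srcE i v : src i v = (dsource i == val v) by apply/asboolP/eqP.
have tgtE i v : tgt i v = (dtarget i == val v) by apply/asboolP/eqP.
have src_star i v : src (dstar i) v = tgt i v by rewrite /src dsource_star.
pose e (i : ddiagonal K') : rat := (-1) ^+ #|dset i|.
have e_star i : e (dstar i) = e i by rewrite /e (card_dset_star hK eul finK).
have e_sqr i : e i * e i = 1 by exact: sgn_sqr.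
have VK (v : vertex K') : vertices K' (val v) by have := valP v; rewrite inE.
have stst i j := sum_normal_normal hK eul flK finK finA i j.
have stsrc i v : \sum_(k <- fset_set [set: ddiagonal K'])
    (step i k)%:R * e k * (src k v)%:R = - (tgt i v)%:R.
  rewrite tgtE -(sum_normal_source hK eul flK finK finA i (val v)).
  by apply: eq_bigr => k _; rewrite srcE.
have srcst v i : \sum_(k <- fset_set [set: ddiagonal K'])
    (src k v)%:R * e k * (step (dstar k) i)%:R = (-1) ^+ n * (src i v)%:R.
  rewrite srcE -(sum_source_normal hK eul flK finK finA (val v) i).
  by apply: eq_bigr => k _; rewrite srcE.
have srcsrc v v' : \sum_(k <- fset_set [set: ddiagonal K'])
    (src k v)%:R * e k * (src k v')%:R = (v == v')%:R * ((-1) ^+ n - 1).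
  rewrite -(inj_eq val_inj).
  rewrite -(sum_source_source hK eul finK finA (val v') (VK v)).
  by apply: eq_bigr => k _; rewrite !srcE.
have QE : @Qbar R _ K' = letter_matrix step tgt by [].
have starK := @dstarK R _ K'.
split.
  rewrite /reciprocal_exists /I_sub_Qbar QE.
  exact: (@letter_matrix_invertible _ _ finA finV step src tgt (@dstar R _ K') e
    starK src_star e_star e_sqr stst stsrc).
apply/funext => w; rewrite /reciprocal /I_sub_Qbar QE.
apply: etrans (@reciprocity _ _ finA finV step src tgt (@dstar R _ K') e starK
  src_star e_star e_sqr stst stsrc _ srcst srcsrc x y
  (fun s => `[< state_source s = val x >]) w _ _) _ => //.
  by move=> v; apply/asboolP/eqP => [/val_inj|->].
rewrite /sscale /path_series_star /path_series smap_char_series //.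
congr (_ * (_ && _)%:R); case: (letters w) => [|c u] /=; first exact/eqP/asboolP.
(* The last letter of the normal path is the reverse of the last letter of [w], so its target is the
   source of the latter. *)
rewrite last_map dtarget_star path_map.
by apply/and3P/asboolP => -[]; [move=> /asboolP ? ? /asboolP ?|
  move=> ? ? ?; split=> //; apply/asboolP].
Qed.
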